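(* Let $L$ be a lattice of dimension $n\ge 6$, of maximal index $2$ and of length $\ell=n$, and let $s$ be the number of pairs $\pm x$ of minimal vectors of $L$. Then: - if $n\equiv 0 \bmod 6$: $s\le 19$ if $n=6$, and $s\le (2n^2+24n-45)/9$ if $n\ge 12$; - if $n\equiv 1 \bmod 6$: $s\le 24$ if $n=7$, and $s\le (2n^2+20n-13)/9$ if $n\ge 13$; - if $n\equiv 2 \bmod 6$: $s\le 32$ if $n=8$, and $s\le (2n^2+22n-25)/9$ if $n\ge 14$; - if $n\equiv 3 \bmod 6$: $s\le 36$ if $n=9$, and $s\le (2n^2+24n-54)/9$ if $n\ge 15$; - if $n\equiv 4 \bmod 6$: $s\le 44$ if $n=10$, and $s\le (2n^2+20n-4)/9$ if $n\ge 16$; - if $n\equiv 5 \bmod 6$: $s\le (2n^2+22n-34)/9$ (for $n\ge 11$).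
   Context: A lattice $L$ of dimension $n$ is a full-rank lattice in an $n$-dimensional Euclidean space $E$. Its minimal vectors are its nonzero vectors of smallest norm. $L$ is well rounded if its minimal vectors span $E$. For a well rounded lattice $L$, the maximal index of $L$ is $\max_M [L:M]$, where $M$ runs through the sublattices of $L$ spanned by $n$ linearly independent minimal vectors of $L$. For a lattice $L$ of maximal index $2$, the length $\ell\le n$ of $L$ is the minimal cardinality $|X|$ of a non-empty set $X$ of linearly independent minimal vectors of $L$ such that $\sum_{x\in X}x\equiv 0 \bmod 2L$. *)

(* Defs.v *)
From HB Require Import structures.
From mathcomp Require Import all_boot all_order all_algebra.
From mathcomp Require Import boolp classical_sets functions cardinality reals.

Set Implicit Arguments.
Unset Strict Implicit.
Unset Printing Implicit Defensive.

Import Order.TTheory GRing.Theory Num.Theory.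

Local Open Scope classical_set_scope.
Local Open Scope card_scope.
Local Open Scope ring_scope.

Definition int_span (E : zmodType) (X : seq E) : set E :=
  [set v | inIntSpan (in_tuple X) v].

Definition is_lattice (R : realType) (E : vectType R) (L : set E) : Prop :=
  exists2 B : seq E, basis_of {:E} B & L = int_span B.

(* The elements of the quotient group [L / M], so that the index [L : M] is the
   cardinality of this set. *)
Definition cosets (E : zmodType) (L M : set E) : set (set E) :=
  [set [set x + y | y in M] | x in L].

(* Minimality is expressed by the squared norm [dot x x]. *)
Definition min_vectors (R : realType) (E : vectType R)
    (dot : {dot E for (@idfun R)}) (L : set E) : set E :=
  [set x | [/\ L x, x != 0 &
    forall y, L y -> y != 0 -> dot x x <= dot y y]].

Definition min_pairs (R : realType) (E : vectType R)
    (dot : {dot E for (@idfun R)}) (L : set E) : set (set E) :=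
  [set [set x; - x] | x in min_vectors dot L].

Definition well_rounded (R : realType) (E : vectType R)
    (dot : {dot E for (@idfun R)}) (L : set E) : Prop :=
  forall v : E, exists2 X : seq E,
    [set` X] `<=` min_vectors dot L & v \in <<X>>%VS.

Definition min_frame (R : realType) (E : vectType R)
    (dot : {dot E for (@idfun R)}) (L : set E) (X : seq E) : Prop :=
  [/\ [set` X] `<=` min_vectors dot L, free X & size X = \dim {:E}].

(* [m] is the maximum of the indices [L : M] over the sublattices [M] spanned
   by [\dim E] independent minimal vectors. *)
Definition has_maximal_index (R : realType) (E : vectType R)
    (dot : {dot E for (@idfun R)}) (L : set E) (m : nat) : Prop :=
  (exists2 X, min_frame dot L X & cosets L (int_span X) #= `I_m) /\
  (forall X, min_frame dot L X -> cosets L (int_span X) #<= `I_m).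

(* A free sequence has no repetition, so it represents a finite set whose
   cardinality is its size. *)
Definition even_min_set (R : realType) (E : vectType R)
    (dot : {dot E for (@idfun R)}) (L : set E) (X : seq E) : Prop :=
  [/\ X != [::], [set` X] `<=` min_vectors dot L, free X &
    exists2 y, L y & \sum_(x <- X) x = y *+ 2].

Definition has_length (R : realType) (E : vectType R)
    (dot : {dot E for (@idfun R)}) (L : set E) (l : nat) : Prop :=
  (exists2 X, even_min_set dot L X & size X = l) /\
  (forall X, even_min_set dot L X -> (l <= size X)%N).

(* Main.v *)
(* Let [e_1, ..., e_n] be independent minimal vectors with half sum [y] in [L].
   Index 2 forces [L] to be the union of [M = int_span e] and [y + M], and the
   coordinates of minimal vectors to be at most 1 in absolute value; length [n]
   then leaves [e_i] and [- e_i] as the only minimal vectors in [M].  The others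
   are half sums [(1/2) \sum_i (-1)^(A i) e_i], indexed by a set [F] of boolean
   rows closed under negation.  Four of these rows may form a 4x4 Hadamard
   matrix on some columns, but then length [n] forbids any further column of the
   same parity.  This exclusion is inherited when a column is deleted, and
   deleting column [i] loses half of the rows whose [i]-th entry is free in [F].
   For [n >= 7] some column has at most 16 such rows: otherwise two of them,
   essentially distinct and at minimal Hamming distance over all columns, lead
   to a contradiction.  Together with [#|F| <= 26] for [n = 6], this gives
   [#|F| <= 8n - 22], hence [s <= 5n - 11], which implies all the bounds. *)
Require Import Defs.
From HB Require Import structures.
From mathcomp Require Import all_boot zify.

Set Implicit Arguments.
Unset Strict Implicit.
Unset Printing Implicit Defensive.

(** * Rows of signs *)

Definition set_col n (i : 'I_n) (b : bool) (A : {ffun 'I_n -> bool}) :=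
  [ffun k => if k == i then b else A k].

Definition neg_row n (A : {ffun 'I_n -> bool}) := [ffun k => ~~ A k].

Definition parity4 n (A B C D : {ffun 'I_n -> bool}) k :=
  A k (+) B k (+) C k (+) D k.

(* Up to signs, the rows [A], [B], [C], [D] form a Hadamard matrix on the
   columns [j x y]: these have the same parity, and exhaust it. *)
Definition admissible n (F : {set {ffun 'I_n -> bool}}) :=
  (forall A, A \in F -> neg_row A \in F) /\
  forall A B C D (j : bool -> bool -> 'I_n) k,
    A \in F -> B \in F -> C \in F -> D \in F ->
    (forall x y, A (j x y) (+) B (j x y) = x) ->
    (forall x y, A (j x y) (+) C (j x y) = y) ->
    (forall x y, parity4 A B C D (j x y) = parity4 A B C D k) ->
    exists x y, k = j x y.

(** In the cube of all rows, these are the endpoints of the edges of direction [i] that lie in [F].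
    Both endpoints are counted, so the cardinality is twice the number of edges. *)
Definition edges n (i : 'I_n) (F : {set {ffun 'I_n -> bool}}) :=
  [set A | (set_col i true A \in F) && (set_col i false A \in F)].

(** The equivalence behind essential distinctness: rows are identified up to a global sign and up to
    the entry in column [i]. *)
Definition sim_off n (i : 'I_n) (A B : {ffun 'I_n -> bool}) :=
  [forall k, (k != i) ==> (A k == B k)] || [forall k, (k != i) ==> (A k != B k)].

Section Rows.
Variables (n : nat).
Implicit Types (i j k : 'I_n) (A B C : {ffun 'I_n -> bool}).

Lemma set_colE i b A k : set_col i b A k = if k == i then b else A k.
Proof. by rewrite ffunE. Qed.

Lemma neg_rowE A k : neg_row A k = ~~ A k. Proof. by rewrite ffunE. Qed.

Lemma neg_rowK : involutive (@neg_row n).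
Proof. by move=> A; apply/ffunP => k; rewrite !ffunE negbK. Qed.

Lemma set_col_id i A : set_col i (A i) A = A.
Proof. by apply/ffunP => k; rewrite ffunE; case: eqP => // ->. Qed.

Lemma set_col_set_col i b c A : set_col i b (set_col i c A) = set_col i b A.
Proof. by apply/ffunP => k; rewrite !ffunE; case: eqP. Qed.

Lemma set_col_neg_row i b A : set_col i b (neg_row A) = neg_row (set_col i (~~ b) A).
Proof. by apply/ffunP => k; rewrite !ffunE; case: eqP => //; rewrite negbK. Qed.

Lemma edges_set_col (F : {set {ffun 'I_n -> bool}}) i b A :
  A \in edges i F -> set_col i b A \in F.
Proof. by rewrite inE => /andP[]; case: b. Qed.

Lemma edges_sub (F : {set {ffun 'I_n -> bool}}) i A : A \in edges i F -> A \in F.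
Proof. by move=> /(edges_set_col (A i)); rewrite set_col_id. Qed.

Lemma edges_neg_row (F : {set {ffun 'I_n -> bool}}) i A :
  admissible F -> A \in edges i F -> neg_row A \in edges i F.
Proof.
move=> [negF _]; rewrite !inE !set_col_neg_row => /andP[? ?].
by rewrite !negF.
Qed.

Lemma sim_offP i A B : reflect
  (exists c, forall k, k != i -> B k = c (+) A k) (sim_off i A B).
Proof.
apply: (iffP orP) => [[/forallP H|/forallP H]|[[] H]].
- by exists false => k /(implyP (H k))/eqP.
- by exists true => k /(implyP (H k)); case: (A k) (B k) => -[].
- by right; apply/forallP => k; apply/implyP => /H ->; case: (A k).
- by left; apply/forallP => k; apply/implyP => /H ->.
Qed.

Lemma sim_off_sym i A B : sim_off i A B = sim_off i B A.
Proof.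
by rewrite /sim_off; congr (_ || _); apply: eq_forallb => k; rewrite [A k == _]eq_sym.
Qed.

Lemma sim_off_trans i A B C : sim_off i A B -> sim_off i B C -> sim_off i A C.
Proof.
move=> /sim_offP[c Hc] /sim_offP[d Hd]; apply/sim_offP; exists (d (+) c) => k Hk.
by rewrite Hd // Hc // addbA.
Qed.

Lemma sim_off_neg_row i A : sim_off i A (neg_row A).
Proof. by apply/sim_offP; exists true => k _; rewrite neg_rowE. Qed.

(** An equivalent row is determined by its entry in column [i] and by a sign. *)
Lemma card_sim_off i A : #|[set B | sim_off i A B]| <= 4.
Proof.
have sub : [set B | sim_off i A B] \subset
    [set set_col i b.1 (if b.2 then neg_row A else A) | b : bool * bool].
  apply/subsetP => B; rewrite inE => /sim_offP[c Hc].
  apply/imsetP; exists (B i, c) => //; apply/ffunP => k.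
  rewrite set_colE /=; case: eqP => [->//|/eqP /Hc ->].
  by case: (c); rewrite ?neg_rowE.
apply: leq_trans (subset_leq_card sub) (leq_trans (leq_imset_card _ _) _).
by rewrite card_prod !card_bool.
Qed.

(** Each row of [s] excludes at most 4 rows, so inequivalent edges can be chosen greedily: more than
    [4 * m] rows contain [m + 1] inequivalent ones. *)
Lemma pick_edge (F : {set {ffun 'I_n -> bool}}) i (s : seq {ffun 'I_n -> bool}) :
  4 * size s < #|edges i F| ->
  exists2 C, C \in edges i F & {in s, forall A, ~~ sim_off i A C}.
Proof.
move=> lt.
have [/subsetPn[C CD CU]|/negbNE sub] :=
  boolP (~~ (edges i F \subset \bigcup_(A <- s) [set B | sim_off i A B])).
  exists C => // A As; apply/negP => AC; case/negP: CU.
  by rewrite bigcup_seq; apply/bigcupP; exists A; rewrite ?inE.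
have := leq_trans lt (subset_leq_card sub); rewrite ltnNge => /negP[].
elim: {lt sub}s => [|A s IH]; first by rewrite big_nil cards0.
rewrite big_cons mulnS; apply: leq_trans (leq_card_setU _ _) _.
by rewrite leq_add ?card_sim_off.
Qed.

End Rows.

(** * Non-constant Boolean functions on a set of columns *)

Section NonConstant.
Variables (n : nat) (S : pred 'I_n).

Lemma const_or_not (f : 'I_n -> bool) :
  (exists c, {in S, forall k, f k = c}) \/
  (exists u v, [/\ u \in S, v \in S & f u != f v]).
Proof.
have [/existsP[u /existsP[v /and3P[uS vS d]]]|N] :=
  boolP [exists u, exists v, [&& u \in S, v \in S & f u != f v]].
  by right; exists u, v.
left; case: (pickP S) => [u uS|S0]; last by exists true => k; rewrite unfold_in S0.
exists (f u) => k kS; apply/eqP; apply: contraNT N => d.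
by apply/existsP; exists k; apply/existsP; exists u; apply/and3P.
Qed.

(** If [g] does not separate [u] and [v], take [t] with [g t] different from their common value;
    since [f] separates [u] and [v], it separates [t] from one of them. *)
Lemma common_diff (f g : 'I_n -> bool) :
  (exists u v, [/\ u \in S, v \in S & f u != f v]) ->
  (exists u v, [/\ u \in S, v \in S & g u != g v]) ->
  exists u v, [/\ u \in S, v \in S, f u != f v & g u != g v].
Proof.
move=> [u [v [uS vS fuv]]] [w [z [wS zS gwz]]].
have [|/negbNE/eqP guv] := boolP (g u != g v); first by exists u, v.
have [t tS gt] : exists2 t, t \in S & g t != g u.
  have [E|] := eqVneq (g w) (g u); last by exists w.
  by exists z; rewrite // -E eq_sym.
have [E|ne] := eqVneq (f t) (f u).
  by exists t, v; rewrite E -guv.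
by exists t, u.
Qed.

End NonConstant.

(** * Consequences of admissibility for two edges of the same direction *)

Section Minimal.
Variables (n : nat) (F : {set {ffun 'I_n -> bool}}).
Hypothesis admF : admissible F.
Implicit Types (i j k u v : 'I_n) (A B C X : {ffun 'I_n -> bool}).

Definition dist_off i A B := #|[set k | (k != i) && (A k != B k)]|.

Definition same i A B : pred 'I_n := [pred k | (k != i) && (A k == B k)].

Variables (i : 'I_n) (A B : {ffun 'I_n -> bool}).
Hypotheses (AD : A \in edges i F) (BD : B \in edges i F).

Variable (j : 'I_n).
Hypotheses (ji : j != i) (ABj : A j != B j).

Lemma same_neq_j k : k \in same i A B -> k != j.
Proof.
by rewrite inE => /andP[_ /eqP E]; apply: contraNneq ABj => <-; rewrite E.
Qed.

(* Columns [i] and [j] can be set at will: they complete [u], [v] to a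
   configuration to which admissibility applies. *)
Lemma parity_off C X u v k :
  C \in edges i F -> X \in edges j F ->
  u \in same i A B -> v \in same i A B ->
  A u (+) C u != A v (+) C v -> A u (+) X u != A v (+) X v ->
  k \notin [:: u; v; i; j] -> parity4 A B C X k = ~~ parity4 A B C X u.
Proof.
move=> CD XD uS vS dC dX; rewrite !inE !negb_or => /and4P[ku kv ki kj].
have [uj vj] := (same_neq_j uS, same_neq_j vS).
move: uS vS; rewrite !inE => /andP[ui /eqP ABu] /andP[vi /eqP ABv].
apply/eqP; rewrite -[_ == _]negbK; apply/negP => /negP/eqP H.
have {}H : parity4 A B C X k = parity4 A B C X u.
  by move: H; case: parity4; case: parity4.
(* Columns [i] and [j] are to be the two where [A] and [B] differ. Column [j] shows [c] as the sum
   of [A] and [C], so column [i] must show [~~ c]. The values [a] and [x] then bring the parities in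
   columns [i] and [j] to the common value [p]. *)
set p := parity4 A B C X u in H; set c := A j (+) C j.
set a := p (+) c (+) X i.
set x := p (+) A j (+) B j (+) C j.
set f : bool -> bool -> 'I_n := fun y z =>
  if y then (if z == c then j else i)
  else (if z == A u (+) C u then u else v).
have E : [/\ set_col i a A u = A u, set_col i (~~ a) B u = B u & set_col j x X u = X u].
  by rewrite !set_colE (negbTE ui) (negbTE uj).
have [] := admF.2 (set_col i a A) (set_col i (~~ a) B) (set_col i (a (+) ~~ c) C)
  (set_col j x X) f k (edges_set_col _ AD) (edges_set_col _ BD) (edges_set_col _ CD)
  (edges_set_col _ XD).
- move=> y z; rewrite /f !set_colE.
  case: y; [case: (eqVneq z c) => [Ez|d] | case: (eqVneq z (A u (+) C u)) => [Ez|d]] => /=.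
  + by rewrite (negbTE ji); move: ABj; case: (A j) (B j) => -[].
  + by rewrite eqxx; case: (a).
  + by rewrite (negbTE ui) ABu addbb.
  + by rewrite (negbTE vi) ABv addbb.
- move=> y z; rewrite /f !set_colE.
  case: y; [case: (eqVneq z c) => [Ez|d] | case: (eqVneq z (A u (+) C u)) => [Ez|d]] => /=.
  + by rewrite (negbTE ji) Ez.
  + by rewrite eqxx; move: d; rewrite addbA addbb; case: (z) (c) => -[].
  + by rewrite (negbTE ui) Ez.
  + rewrite (negbTE vi); move: d dC.
    by case: (z) (A u (+) C u) (A v (+) C v) => -[] [].
- move=> y z; have -> : parity4 (set_col i a A) (set_col i (~~ a) B)
      (set_col i (a (+) ~~ c) C) (set_col j x X) k = p.
    by rewrite /parity4 !set_colE (negbTE ki) (negbTE kj) -H.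
  rewrite /f /parity4 !set_colE.
  case: y; [case: (eqVneq z c) => [Ez|d] | case: (eqVneq z (A u (+) C u)) => [Ez|d]] => /=.
  + rewrite (negbTE ji) eqxx /x.
    by case: (p) (A j) (B j) (C j) => -[] [] [].
  + rewrite eqxx [i == j]eq_sym (negbTE ji) /a.
    by case: (p) (c) (X i) => -[] [].
  + by rewrite (negbTE ui) (negbTE uj).
  + rewrite (negbTE vi) (negbTE vj) /p /parity4 ABu ABv.
    move: dC dX; rewrite ABu ABv.
    by case: (B u) (B v) (C u) (C v) (X u) (X v) => -[] [] [] [] [].
- move=> y [z]; rewrite /f => Ek; move: ku kv ki kj; rewrite Ek.
  by case: y {Ek}; case: ifP => _; rewrite eqxx.
Qed.

(** Choose the sign of [C] so that it agrees with [A] at [v], and let [u] be a column of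
    [same i A B] where they differ. Then [parity_off] applies to [u] and [v]; the parity at [u] is
    odd, so it is even on all remaining columns, and this determines [C'] from [A], [B] and [X]. *)
Lemma singleton_rows X v C :
  X \in edges j F -> v \in same i A B ->
  {in same i A B, forall k, A k (+) X k = (k == v)} ->
  C \in edges i F ->
  (exists w z, [/\ w \in same i A B, z \in same i A B &
     A w (+) C w != A z (+) C z]) ->
  exists C' u, [/\ C' \in edges i F, sim_off i C C', (u \in same i A B) && (u != v),
    {in same i A B, forall k, A k (+) C' k = (k == u)} &
    forall k, k != i -> k != j -> A k != B k -> C' k = ~~ X k].
Proof.
move=> XD vS HX CD [w [z [wS zS d]]].
pose C' := if A v (+) C v then neg_row C else C.
have C'D : C' \in edges i F by rewrite /C'; case: ifP; rewrite ?edges_neg_row.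
have CC' : sim_off i C C'.
  rewrite /C'; case: ifP => _; first exact: sim_off_neg_row.
  by apply/sim_offP; exists false.
have C'v : A v (+) C' v = false.
  by rewrite /C'; case: ifP => //; rewrite neg_rowE addbN => ->.
have [u uS C'u] : exists2 u, u \in same i A B & A u (+) C' u = true.
  have d' : A w (+) C' w != A z (+) C' z.
    rewrite /C'; case: ifP => // _; rewrite !neg_rowE !addbN.
    by move: d; case: (_ (+) _) (_ (+) _) => -[].
  have [Cw|Cw] := boolP (A w (+) C' w); first by exists w.
  by exists z => //; move: d'; rewrite (negbTE Cw); case: (A z (+) C' z).
have uv : u != v by apply: contraTneq C'u => ->; rewrite C'v.
have Q k : k \notin [:: u; v; i; j] -> parity4 A B C' X k = false.
  move=> /(parity_off C'D XD uS vS); rewrite C'u C'v !HX // eqxx (negbTE uv).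
  move=> /(_ isT isT) ->; have := HX u uS; rewrite (negbTE uv).
  move: uS C'u; rewrite /parity4 inE => /andP[_ /eqP ->].
  by case: (B u) (C' u) (X u) => -[] [].
exists C', u; split=> // [|k|k]; first by rewrite uS.
- move=> kS; have [->//|ku] := eqVneq k u.
  have [->//|kv] := eqVneq k v.
  have kj := same_neq_j kS; have := kS; rewrite inE => /andP[ki /eqP ABk].
  have := Q k; rewrite !inE !negb_or ku kv ki kj /parity4 ABk => /(_ isT).
  have := HX k kS; rewrite (negbTE kv) ABk.
  by case: (B k) (C' k) (X k) => -[] [].
- move=> ki kj ABk.
  have nS t : t \in same i A B -> k != t.
    by rewrite inE => /andP[_ E]; apply: contraNneq ABk => ->.
  have := Q k; rewrite !inE !negb_or (nS u) // (nS v) // ki kj /parity4 => /(_ isT).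
  by move: ABk; case: (A k) (B k) (C' k) (X k) => -[] [] [].
Qed.

(** If [u1] and [u2] were distinct, the rows [A], [C1], [C2], [X] would form a Hadamard matrix on
    the columns [v], [u1], [u2], [i], all of odd parity. As [X] is free in column [j], that column
    can be made odd too, which admissibility forbids. *)
Lemma singleton_uniq X v C1 C2 u1 u2 :
  X \in edges j F -> v \in same i A B ->
  {in same i A B, forall k, A k (+) X k = (k == v)} ->
  C1 \in edges i F -> u1 \in same i A B -> u1 != v ->
  {in same i A B, forall k, A k (+) C1 k = (k == u1)} ->
  C2 \in edges i F -> u2 \in same i A B -> u2 != v ->
  {in same i A B, forall k, A k (+) C2 k = (k == u2)} -> u1 = u2.
Proof.
move=> XD vS HX C1D u1S u1v H1 C2D u2S u2v H2; apply/eqP.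
have [//|u12] := boolP (u1 == u2).
have [[u1j u2j] vj] := (same_neq_j u1S, same_neq_j u2S, same_neq_j vS).
have [u1i u2i vi] : [/\ u1 != i, u2 != i & v != i].
  by move: u1S u2S vS; rewrite !inE => /andP[? _] /andP[? _] /andP[? _].
(* The value [a] makes column [i] odd, and [x] makes the extra column [j] odd. *)
set a := ~~ X i.
set x := ~~ (A j (+) C1 j (+) C2 j).
set f : bool -> bool -> 'I_n := fun y z =>
  if y then (if z then i else u1) else (if z then u2 else v).
have jif : (j == i) = false by apply: negbTE.
have ijf : (i == j) = false by rewrite eq_sym jif.
have [] := admF.2 (set_col i a A) (set_col i (~~ a) C1) (set_col i (~~ a) C2)
  (set_col j x X) f j (edges_set_col _ AD) (edges_set_col _ C1D) (edges_set_col _ C2D)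
  (edges_set_col _ XD).
- move=> [] []; rewrite /f !set_colE ?eqxx ?(negbTE u1i) ?(negbTE u2i) ?(negbTE vi) //.
  + by case: (a).
  + by rewrite H1 ?eqxx.
  + by rewrite H1 // eq_sym (negbTE u12).
  + by rewrite H1 // eq_sym (negbTE u1v).
- move=> [] []; rewrite /f !set_colE ?eqxx ?(negbTE u1i) ?(negbTE u2i) ?(negbTE vi) //.
  + by case: (a).
  + by rewrite H2 // (negbTE u12).
  + by rewrite H2 ?eqxx.
  + by rewrite H2 // eq_sym (negbTE u2v).
- move=> y z; have -> : parity4 (set_col i a A) (set_col i (~~ a) C1)
      (set_col i (~~ a) C2) (set_col j x X) j = true.
    by rewrite /parity4 !set_colE jif eqxx /x; case: (A j) (C1 j) (C2 j) => -[] [].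
  have E k : k \in same i A B -> parity4 A C1 C2 X k =
      (k == u1) (+) (k == u2) (+) (k == v).
    move=> kS; rewrite /parity4 -H1 // -H2 // -HX //.
    by case: (A k) (C1 k) (C2 k) (X k) => -[] [] [].
  rewrite /parity4 !set_colE; case: y; case: z => /=.
  + by rewrite eqxx ijf /a; case: (X i).
  + rewrite (negbTE u1i) (negbTE u1j); have := E _ u1S.
    by rewrite /parity4 eqxx (negbTE u12) (negbTE u1v).
  + rewrite (negbTE u2i) (negbTE u2j); have := E _ u2S.
    by rewrite /parity4 eqxx eq_sym (negbTE u12) (negbTE u2v).
  + rewrite (negbTE vi) (negbTE vj); have := E _ vS.
    by rewrite /parity4 eqxx ![v == _]eq_sym (negbTE u1v) (negbTE u2v).
- move=> y [z]; rewrite /f.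
  by case: y; case: z => E; move: ji u1j u2j vj; rewrite E ?eqxx.
Qed.

End Minimal.

(** * A closest pair of inequivalent edges *)

Section FewEdges.
Variables (n : nat) (F : {set {ffun 'I_n -> bool}}).
Hypothesis admF : admissible F.
Implicit Types (i j k u v : 'I_n) (A B C X : {ffun 'I_n -> bool}).

Lemma exists_closest_edges i0 :
  8 < #|edges i0 F| ->
  exists i A B, [/\ A \in edges i F, B \in edges i F, ~~ sim_off i A B &
    forall i' A' B', A' \in edges i' F -> B' \in edges i' F ->
      ~~ sim_off i' A' B' -> dist_off i A B <= dist_off i' A' B'].
Proof.
move=> big.
have [|A0 A0D _] := @pick_edge _ F i0 [::]; first exact: leq_ltn_trans big.
have [|B0 B0D AB0] := @pick_edge _ F i0 [:: A0].
  by apply: leq_ltn_trans big.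
pose P (t : 'I_n * ({ffun 'I_n -> bool} * {ffun 'I_n -> bool})) :=
  [&& t.2.1 \in edges t.1 F, t.2.2 \in edges t.1 F & ~~ sim_off t.1 t.2.1 t.2.2].
have P0 : P (i0, (A0, B0)) by rewrite /P /= A0D B0D AB0 ?mem_head.
case: (arg_minnP (fun t => dist_off t.1 t.2.1 t.2.2) P0) => -[i [A B]].
rewrite /P /= => /and3P[AD BD AB] H.
exists i, A, B; split=> // i' A' B' h1 h2 h3.
by apply: (H (i', (A', B'))); rewrite /= h1 h2.
Qed.

Variables (i : 'I_n) (A B : {ffun 'I_n -> bool}).
Hypotheses (AD : A \in edges i F) (BD : B \in edges i F).
Hypothesis closest : forall i' A' B', A' \in edges i' F -> B' \in edges i' F ->
  ~~ sim_off i' A' B' -> dist_off i A B <= dist_off i' A' B'.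

(* Otherwise [C] or its negation lies strictly between [A] and [B]. *)
Lemma edge_nonconst C :
  C \in edges i F -> ~~ sim_off i A C -> ~~ sim_off i B C ->
  exists w z, [/\ w \in same i A B, z \in same i A B &
    A w (+) C w != A z (+) C z].
Proof.
move=> CD AC BC.
have [[c Hc]|//] := const_or_not (same i A B) (fun k => A k (+) C k).
pose C' := if c then neg_row C else C.
have C'D : C' \in edges i F by rewrite /C'; case: ifP; rewrite ?edges_neg_row.
have C'E k : C' k = c (+) C k.
  by rewrite /C'; case: (c) => //; rewrite neg_rowE.
have CC' : sim_off i C C' by apply/sim_offP; exists c.
have C'S k : k \in same i A B -> C' k = A k.
  by move=> kS; rewrite C'E -(Hc k kS) -addbA addbb addbF.
have AC' : ~~ sim_off i A C'.
  by apply: contra AC => h; apply: sim_off_trans h _; rewrite sim_off_sym.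
(* If no such column existed, [C'] would coincide with [B] off [i]. At this [k], [C'] agrees with
   [A] while [B] does not, so [C'] is strictly closer to [A] than [B] is. *)
have [k /and3P[ki ABk /eqP C'k]] :
    exists k, [&& k != i, A k != B k & C' k == A k].
  apply/existsP; apply: contraNT BC.
  rewrite negb_exists => /forallP H; apply: (@sim_off_trans _ _ _ C'); last by rewrite sim_off_sym.
  apply/sim_offP; exists false => k ki.
  have [ABk|ABk] := boolP (A k == B k).
    by rewrite C'S ?inE ?ki // (eqP ABk).
  by have := H k; rewrite ki ABk /=; case: (A k) (B k) (C' k) ABk => -[] [].
have := closest AD C'D AC'; rewrite leqNgt => /negP[].
apply: proper_card; apply/properP; split.
  apply/subsetP => l; rewrite !inE => /andP[li Cl]; rewrite li /=.
  by apply: contraNneq Cl => E; rewrite C'S // inE li E eqxx.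
by exists k; rewrite !inE ki ?ABk // C'k eqxx.
Qed.

Lemma exists_nonconst j :
  j != i -> A j != B j -> 8 < #|edges j F| ->
  exists2 X, X \in edges j F &
  exists w z, [/\ w \in same i A B, z \in same i A B &
    A w (+) X w != A z (+) X z].
Proof.
move=> ji ABj big.
have [/exists_inP[X XD /existsP[w /existsP[z /and3P[]]]]|N] := boolP
  [exists X in edges j F, exists w, exists z,
  [&& w \in same i A B, z \in same i A B & A w (+) X w != A z (+) X z]].
  by exists X => //; exists w, z.
(* In the remaining case every row of [edges j F] agrees with [A] up to sign on [same i A B]; the
   sign is normalized away. *)
have normal_code Y : Y \in edges j F -> exists Y', [/\ Y' \in edges j F, sim_off j Y Y' &
    {in same i A B, forall k, Y' k = A k}].
  move=> YD.
  have [[c Hc]|[w [z [wS zS d]]]] :=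
      const_or_not (same i A B) (fun k => A k (+) Y k); last first.
    case/negP: N; apply/exists_inP; exists Y => //.
    by apply/existsP; exists w; apply/existsP; exists z; apply/and3P.
  exists (if c then neg_row Y else Y); split.
  - by case: ifP; rewrite ?edges_neg_row.
  - by apply/sim_offP; exists c => k _; case: (c) => //; rewrite neg_rowE.
  - move=> k kS; have := Hc k kS; case: (c); rewrite ?neg_rowE;
      by case: (A k) (Y k) => -[].
(* More than 8 rows, in classes of at most 4, give three inequivalent ones. *)
have [|Y1 Y1D _] := @pick_edge _ F j [::]; first exact: leq_ltn_trans big.
have [|Y2 Y2D H2] := @pick_edge _ F j [:: Y1]; first exact: leq_ltn_trans big.
have [|Y3 Y3D H3] := @pick_edge _ F j [:: Y1; Y2]; first exact: leq_ltn_trans big.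
have [Z1 [Z1D e1 s1]] := normal_code _ Y1D.
have [Z2 [Z2D e2 s2]] := normal_code _ Y2D.
have [Z3 [Z3D e3 s3]] := normal_code _ Y3D.
have neqv Y Y' Z Z' : ~~ sim_off j Y Y' -> sim_off j Y Z -> sim_off j Y' Z' -> ~~ sim_off j Z Z'.
  move=> h1 h2 h3; apply: contra h1 => h; apply: sim_off_trans h2 _.
  by apply: sim_off_trans h _; rewrite sim_off_sym.
have n12 : ~~ sim_off j Z1 Z2 by apply: neqv e1 e2; apply: H2; rewrite mem_head.
have n13 : ~~ sim_off j Z1 Z3 by apply: neqv e1 e3; apply: H3; rewrite !inE eqxx.
have n23 : ~~ sim_off j Z2 Z3 by apply: neqv e2 e3; apply: H3; rewrite !inE eqxx orbT.
(* Two elements of [edges j F] that agree with [A] where [B] does can differ only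
   within [Q]; as [#|Q| = dist_off i A B], minimality makes them differ on all of
   it, which is impossible for three rows. *)
pose Q := i |: ([set k | (k != i) && (A k != B k)] :\ j).
have cQ : #|Q| = dist_off i A B.
  rewrite /Q cardsU1 !inE eqxx andbF /= /dist_off (cardsD1 j [set k | _ && _]).
  by rewrite !inE ji ABj.
have full Z Z' : Z \in edges j F -> Z' \in edges j F -> ~~ sim_off j Z Z' ->
    {in same i A B, forall k, Z k = A k} -> {in same i A B, forall k, Z' k = A k} ->
    forall k, k \in Q -> Z k != Z' k.
  move=> ZD Z'D ZZ' s s'.
  have sub : [set k | (k != j) && (Z k != Z' k)] \subset Q.
    apply/subsetP => k; rewrite !inE => /andP[-> d].
    case: eqVneq => //= ki; apply: contraNneq d => E.
    by rewrite s ?s' // inE ki E eqxx.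
  have /eqP E : [set k | (k != j) && (Z k != Z' k)] == Q.
    by rewrite eqEcard sub cQ; apply: closest.
  by move=> k; rewrite -E inE => /andP[].
case/negP: n23; apply/sim_offP; exists false => k kj.
have [kS|kS] := boolP (k \in same i A B); first by rewrite s2 ?s3.
have kQ : k \in Q.
  move: kS; rewrite !inE kj negb_and negbK.
  by case: eqVneq.
have := full _ _ Z1D Z2D n12 s1 s2 _ kQ; have := full _ _ Z1D Z3D n13 s1 s3 _ kQ.
by case: (Z1 k) (Z2 k) (Z3 k) => -[] [].
Qed.

(** Both [C] and [X] separate some [u] and [v], so [parity_off] fixes the parity on all columns
    outside [u], [v], [i], [j]. The proof splits according to whether [C] is constant relative to
    [A] on the rest of [same i A B]. *)
Lemma exists_singleton j C X :
  6 < n -> j != i -> A j != B j ->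
  C \in edges i F -> X \in edges j F ->
  (exists w z, [/\ w \in same i A B, z \in same i A B &
    A w (+) C w != A z (+) C z]) ->
  (exists w z, [/\ w \in same i A B, z \in same i A B &
    A w (+) X w != A z (+) X z]) ->
  exists2 X', X' \in edges j F & exists2 v, v \in same i A B &
    {in same i A B, forall k, A k (+) X' k = (k == v)}.
Proof.
move=> n7 ji ABj CD XD ncC ncX.
have [u [v [uS vS dC dX]]] := common_diff ncC ncX.
have Q := parity_off admF AD BD ji ABj CD XD uS vS dC dX.
have parS k : k \in same i A B -> parity4 A B C X k = A k (+) C k (+) (A k (+) X k).
  rewrite inE /parity4 => /andP[_ /eqP ->].
  by case: (B k) (C k) (X k) => -[] [].
have [[c Hc]|[u' [v' [u'S v'S dC']]]] :=
    const_or_not [pred k in same i A B | k \notin [:: u; v]] (fun k => A k (+) C k).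
(* Here [X] is constant relative to [A] off [u] and [v] as well. Since it separates these two, after
   a sign change it differs from [A] at exactly one of them. *)
- pose d := c (+) ~~ parity4 A B C X u.
  have Xk k : k \in same i A B -> k != u -> k != v -> A k (+) X k = d.
    move=> kS ku kv; have kj := same_neq_j ABj kS.
    have ki : k != i by case/andP: kS.
    have := Q k; rewrite !inE !negb_or ku kv ki kj parS // /d => /(_ isT) <-.
    rewrite -(Hc k) ?inE; first by rewrite addbA addbb.
    by rewrite (negbTE ku) (negbTE kv) andbT; move: kS; rewrite inE.
  pose X' := if d then neg_row X else X.
  have X'E k : X' k = d (+) X k by rewrite /X'; case: (d) => //; rewrite neg_rowE.
  exists X'; first by rewrite /X'; case: ifP; rewrite ?edges_neg_row.
  have [Eu|Nu] := eqVneq (A u (+) X u) d.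
    exists v => // k kS; rewrite X'E addbCA.
    have [->|kv] := eqVneq k v.
      by move: dX Eu; case: (A u (+) X u) (A v (+) X v) (d) => -[] [].
    by have [->|ku] := eqVneq k u; rewrite ?Eu ?Xk ?addbb.
  exists u => // k kS; rewrite X'E addbCA.
  have [->|ku] := eqVneq k u.
    by move: Nu; case: (A u (+) X u) (d) => -[].
  have [->|kv] := eqVneq k v; last by rewrite Xk ?addbb.
  by move: Nu dX; case: (A u (+) X u) (A v (+) X v) (d) => -[] [].
- move: u'S v'S; rewrite /= ![_ \in [pred k in _ | _]]inE => /andP[u'S nu'] /andP[v'S nv'].
  have ij t : t \in same i A B -> (t != i) && (t != j).
    by move=> tS; rewrite (same_neq_j ABj tS) andbT; case/andP: tS.
  have par_uv t : t \in same i A B -> t \notin [:: u; v] ->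
      parity4 A B C X t = ~~ parity4 A B C X u.
    move=> tS nt; apply: Q; move: nt (ij _ tS); rewrite !inE !negb_or.
    by move=> /andP[-> ->] /andP[-> ->].
  have dX' : A u' (+) X u' != A v' (+) X v'.
    have := par_uv _ u'S nu'; rewrite -(par_uv _ v'S nv') !parS //.
    move: dC'; case: (A u' (+) C u') (A v' (+) C v') => -[] //= _;
      by case: (A u' (+) X u') (A v' (+) X v') => -[].
  have Q' := parity_off admF AD BD ji ABj CD XD u'S v'S dC' dX'.
  (* This is where [n >= 7] enters: a column remains beyond the six listed. Its parity should be
     opposite to those at [u] and at [u'], which are opposite to each other. *)
  have [k] : exists k, k \notin [:: u; v; i; j; u'; v'].
    apply/existsP; rewrite -negb_forall; apply/negP => /forallP H.
    have : size (enum 'I_n) <= size [:: u; v; i; j; u'; v'].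
      by apply: uniq_leq_size; rewrite ?enum_uniq.
    by rewrite size_enum_ord leqNgt n7.
  rewrite !inE !negb_or => /and5P[ku kv ki kj /andP[ku' kv']].
  have := Q k; have := Q' k; rewrite !inE !negb_or ku kv ki kj ku' kv' /=.
  move=> /(_ isT) -> /(_ isT); rewrite (par_uv _ u'S nu').
  by case: parity4.
Qed.

(** More than 16 rows give [C1], [C2], [C3] inequivalent to [A], [B] and to each other. Relative to
    a singleton row [X] they normalize to [E1], [E2], [E3], which by uniqueness share the column
    [u1] and hence agree off [i] and [j]. Two of the three also agree in column [j], so they are
    equivalent, a contradiction. *)
Lemma no_closest_edges : 6 < n -> ~~ sim_off i A B ->
  (forall j, 16 < #|edges j F|) -> False.
Proof.
move=> n7 AB big.
have [j /andP[ji ABj]] : exists j, (j != i) && (A j != B j).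
  apply/existsP; apply: contraNT AB; rewrite negb_exists => /forallP H.
  apply/sim_offP; exists false => k ki; have := H k; rewrite ki negbK.
  by move=> /eqP.
have big8 k : 8 < #|edges k F| by exact: leq_trans (big k).
have pick (s : seq {ffun 'I_n -> bool}) : size s <= 4 ->
    exists2 C, C \in edges i F & {in s, forall D, ~~ sim_off i D C}.
  by move=> ss; apply: pick_edge; apply: leq_ltn_trans (big i); rewrite -[16]/(4 * 4) leq_mul2l.
have [C1 C1D h1] := pick [:: A; B] isT.
have [C2 C2D h2] := pick [:: A; B; C1] isT.
have [C3 C3D h3] := pick [:: A; B; C1; C2] isT.
have nc C : C \in edges i F -> {in [:: A; B], forall D, ~~ sim_off i D C} ->
    exists w z, [/\ w \in same i A B, z \in same i A B &
    A w (+) C w != A z (+) C z].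
  by move=> CD h; apply: edge_nonconst => //; apply: h; rewrite !inE eqxx ?orbT.
have nc1 := nc _ C1D h1.
have nc2 : exists w z, [/\ w \in same i A B, z \in same i A B &
    A w (+) C2 w != A z (+) C2 z].
  by apply: nc => // D hD; apply: h2; move: hD; rewrite !inE => /orP[] ->; rewrite ?orbT.
have nc3 : exists w z, [/\ w \in same i A B, z \in same i A B &
    A w (+) C3 w != A z (+) C3 z].
  by apply: nc => // D hD; apply: h3; move: hD; rewrite !inE => /orP[] ->; rewrite ?orbT.
have [X0 X0D ncX] := exists_nonconst ji ABj (big8 j).
have [X XD [v vS HX]] := exists_singleton n7 ji ABj C1D X0D nc1 ncX.
have sing := singleton_rows admF AD BD ji ABj XD vS HX.
have [E1 [u1 [E1D CE1 /andP[u1S u1v] HE1 P1]]] := sing _ C1D nc1.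
have [E2 [u2 [E2D CE2 /andP[u2S u2v] HE2 P2]]] := sing _ C2D nc2.
have [E3 [u3 [E3D CE3 /andP[u3S u3v] HE3 P3]]] := sing _ C3D nc3.
have uniq := singleton_uniq admF AD ji ABj XD vS HX.
have u12 := uniq _ _ _ _ E1D u1S u1v HE1 E2D u2S u2v HE2.
have u13 := uniq _ _ _ _ E1D u1S u1v HE1 E3D u3S u3v HE3.
subst u2 u3.
have agree (E E' : {ffun 'I_n -> bool}) : {in same i A B, forall k, A k (+) E k = (k == u1)} ->
    (forall k, k != i -> k != j -> A k != B k -> E k = ~~ X k) ->
    {in same i A B, forall k, A k (+) E' k = (k == u1)} ->
    (forall k, k != i -> k != j -> A k != B k -> E' k = ~~ X k) ->
    E j = E' j -> sim_off i E E'.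
  move=> H P H' P' Ej; apply/sim_offP; exists false => k ki /=.
  have [->|kj] := eqVneq k j; first by rewrite Ej.
  have [ABk|ABk] := boolP (A k == B k); last by rewrite P ?P'.
  have kS : k \in same i A B by rewrite inE ki.
  by have := H k kS; rewrite -(H' k kS); case: (A k) (E k) (E' k) => -[] [].
have neqv C C' E E' : ~~ sim_off i C C' -> sim_off i C E -> sim_off i C' E' -> ~~ sim_off i E E'.
  move=> k1 k2 k3; apply: contra k1 => h; apply: sim_off_trans k2 _.
  by apply: sim_off_trans h _; rewrite sim_off_sym.
have n12 : ~~ sim_off i E1 E2 by apply: neqv CE1 CE2; apply: h2; rewrite !inE eqxx !orbT.
have n13 : ~~ sim_off i E1 E3 by apply: neqv CE1 CE3; apply: h3; rewrite !inE eqxx !orbT.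
have n23 : ~~ sim_off i E2 E3 by apply: neqv CE2 CE3; apply: h3; rewrite !inE eqxx !orbT.
have d12 : E1 j != E2 j by apply: contraNneq n12; apply: agree.
have d13 : E1 j != E3 j by apply: contraNneq n13; apply: agree.
have d23 : E2 j != E3 j by apply: contraNneq n23; apply: agree.
by move: d12 d13 d23; case: (E1 j) (E2 j) (E3 j) => -[] [].
Qed.

End FewEdges.

Lemma few_edges n (F : {set {ffun 'I_n -> bool}}) :
  admissible F -> 6 < n -> exists i, #|edges i F| <= 16.
Proof.
move=> admF n7; apply/existsP; apply: contraT.
rewrite negb_exists => /forallP big'.
have big j : 16 < #|edges j F| by rewrite ltnNge.
have i0 : 'I_n by apply: (@Ordinal _ 0); apply: leq_trans n7.
have [|i [A [B [AD BD AB H]]]] := @exists_closest_edges n F i0.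
  exact: leq_trans (big i0).
by case: (no_closest_edges admF AD BD H n7 AB big).
Qed.

(** * Deleting a column *)

Definition del_col n (i : 'I_n.+1) (A : {ffun 'I_n.+1 -> bool}) :=
  [ffun k : 'I_n => A (lift i k)].

Lemma admissible_del_col n (i : 'I_n.+1) (F : {set {ffun 'I_n.+1 -> bool}}) :
  admissible F -> admissible (del_col i @: F).
Proof.
move=> [negF H]; split.
  move=> _ /imsetP[A AF ->]; apply/imsetP; exists (neg_row A); first exact: negF.
  by apply/ffunP => k; rewrite !ffunE.
move=> _ _ _ _ j k /imsetP[A AF ->] /imsetP[B BF ->] /imsetP[C CF ->] /imsetP[D DF ->].
move=> HB HC HD; have [||x y|x [y /lift_inj ->]] :=
  H A B C D (fun x y => lift i (j x y)) (lift i k) AF BF CF DF.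
- by move=> x y; rewrite -[RHS](HB x y) !ffunE.
- by move=> x y; rewrite -[RHS](HC x y) !ffunE.
- by have := HD x y; rewrite /parity4 !ffunE.
- by exists x, y.
Qed.

Lemma card_edges n (i : 'I_n) (F : {set {ffun 'I_n -> bool}}) :
  #|edges i F| = 2 * #|[set A in edges i F | ~~ A i]|.
Proof.
rewrite -(cardsID [set A : {ffun 'I_n -> bool} | A i] (edges i F)).
have -> : edges i F :\: [set A : {ffun 'I_n -> bool} | A i] =
    [set A in edges i F | ~~ A i] by apply/setP => A; rewrite !inE andbC.
suff -> : edges i F :&: [set A : {ffun 'I_n -> bool} | A i] =
    set_col i true @: [set A in edges i F | ~~ A i].
  rewrite card_in_imset ?mul2n ?addnn // => A B; rewrite !inE.
  move=> /andP[_ Ai] /andP[_ Bi] /ffunP E; apply/ffunP => k.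
  have := E k; rewrite !set_colE; case: eqP => // -> _.
  by rewrite (negbTE Ai) (negbTE Bi).
apply/setP => A; apply/setIP/imsetP => [[AD]|[B]]; rewrite inE.
  move=> Ai; exists (set_col i false A); last by rewrite set_col_set_col -{1}(set_col_id i A) Ai.
  by move: AD; rewrite !inE !set_col_set_col !set_colE eqxx => ->.
by move=> /andP[BD _] ->; move: BD; rewrite !inE !set_col_set_col !set_colE eqxx.
Qed.

(** Deletion is two-to-one on [edges i F] and injective on the other rows. Removing from [F] one
    endpoint of each edge, the set [G], leaves a system of representatives for the image. *)
Lemma card_del_col n (i : 'I_n.+1) (F : {set {ffun 'I_n.+1 -> bool}}) :
  2 * #|F| = 2 * #|del_col i @: F| + #|edges i F|.
Proof.
rewrite card_edges -mulnDr; congr (_ * _).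
set G := [set A in edges i F | ~~ A i].
have set_col_del b (A : {ffun 'I_n.+1 -> bool}) : del_col i (set_col i b A) = del_col i A.
  by apply/ffunP => k; rewrite !ffunE eq_sym (negbTE (neq_lift _ _)).
have del_inj (A B : {ffun 'I_n.+1 -> bool}) : A i = B i -> del_col i A = del_col i B -> A = B.
  move=> E /ffunP H; apply/ffunP => k; case: (unliftP i k) => [l ->|-> //].
  by have := H l; rewrite !ffunE.
have sub : G \subset F by apply/subsetP => A; rewrite inE => /andP[/edges_sub].
rewrite -(cardsID G F) (setIidPr sub) addnC; congr (_ + _).
rewrite -[LHS](card_in_imset (f := del_col i)).
  congr #|pred_of_set _|; apply/setP => B; apply/imsetP/imsetP => -[A AF ->].
    by exists A => //; move: AF; rewrite inE => /andP[].
  have [AG|AG] := boolP (A \in G); last by exists A; rewrite // inE AG AF.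
  exists (set_col i true A); last by rewrite set_col_del.
  rewrite inE (@edges_set_col _ F); last by case/setIdP: AG.
  by rewrite inE set_colE eqxx andbF.
move=> A B /setDP[AF nA] /setDP[BF nB] E.
have EB b : set_col i b A = set_col i b B.
  by apply: del_inj; rewrite ?set_colE ?eqxx // !set_col_del.
have sA : set_col i (A i) A = A by rewrite set_col_id.
have sB : set_col i (B i) B = B by rewrite set_col_id.
apply: del_inj => //; case Ai: (A i) sA; case Bi: (B i) sB => // sB sA.
  by case/negP: nB; rewrite !inE Bi -EB sA sB AF BF.
by case/negP: nA; rewrite !inE Ai EB sA sB AF BF.
Qed.

(** * Dimensions 5 and 6 *)

(* Conditionals instead of boolean connectives, so that call-by-value
   evaluation short-circuits. *)
Fixpoint lazy_all (T : Type) (p : T -> bool) (s : seq T) :=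
  if s is x :: s' then if p x then lazy_all p s' else false else true.

Lemma lazy_allE (T : Type) (p : T -> bool) s : lazy_all p s = all p s.
Proof. by elim: s => //= x s ->; case: (p x). Qed.

(** A column is recorded as the sums of the first row with the second and with the third, followed
    by the parity. The forbidden pattern is that columns of parity [p] realize all four pairs of
    sums and include at least a fifth column. *)
Definition hadamard_cols (p : bool) (cols : seq (bool * bool * bool)) :=
  let cp := [seq c.1 | c <- cols & c.2 == p] in
  if 4 < size cp then all (fun c => c \in cp)
    [:: (false, false); (false, true); (true, false); (true, true)]
  else false.

(** Each component sums an even number of rows, so adding a fixed row to all four changes nothing.
    This allows the search to work with translated families. *)
Definition cols4 (a b c d : seq bool) :=
  [seq (x.1.1 (+) x.1.2, x.1.1 (+) x.2.1, x.1.1 (+) x.1.2 (+) x.2.1 (+) x.2.2)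
    | x <- zip (zip a b) (zip c d)].

Definition admissible4 a b c d :=
  let s := cols4 a b c d in if hadamard_cols true s then false else ~~ hadamard_cols false s.

Definition compat (fam : seq (seq bool)) x y :=
  lazy_all (fun a => lazy_all (fun b => admissible4 a b x y) fam) fam.

(** Branching on whether the first candidate joins the family; the answer [true] certifies that
    fewer than [k] candidates can belong to it. Every step consumes a candidate, so the number of
    candidates is enough fuel. *)
Fixpoint search fuel (fam cands : seq (seq bool)) k :=
  if size cands < k then true else
  if fuel is fuel'.+1 then
    if (k, cands) is (k'.+1, x :: r) then
      if search fuel' (x :: fam) [seq y <- r | compat fam x y] k'
      then search fuel' fam r k else false
    else false
  else false.

(** If the forced codes are incompatible, no family contains them all and the answer is vacuously
    [true]. *)
Fixpoint force forced (fam cands : seq (seq bool)) k :=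
  if forced is x :: f then
    if lazy_all (compat fam x) f
    then force f (x :: fam) [seq y <- cands | compat fam x y] k else true
  else search (size cands) fam cands k.

Fixpoint bitseqs n : seq (seq bool) :=
  if n is n'.+1 then
    map (cons false) (bitseqs n') ++ map (cons true) (bitseqs n')
  else [:: [::]].

Lemma cons_inj (T : Type) (x : T) : injective (cons x).
Proof. by move=> s t []. Qed.

Lemma mem_bitseqs n s : (s \in bitseqs n) = (size s == n).
Proof.
elim: n s => [|n IH] [|b s] //=.
  by rewrite mem_cat; apply/negP => /orP[] /mapP[].
rewrite eqSS -IH mem_cat; case: b; rewrite (mem_map (@cons_inj _ _)).
  by case: mapP => // -[? _ []].
by rewrite orbC; case: mapP => // -[? _ []].
Qed.

Lemma uniq_bitseqs n : uniq (bitseqs n).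
Proof.
elim: n => //= n IH; rewrite cat_uniq !(map_inj_uniq (@cons_inj _ _)) IH /= andbT.
by apply/hasPn => s /mapP[t _ ->]; apply/mapP => -[].
Qed.

(** Families are closed under negation, so each opposite pair is represented by the code that starts
    with [false]. *)
Definition normal_code (s : seq bool) := if head false s then map negb s else s.

Definition star_codes n (m : seq bool) :=
  nseq n false :: [seq normal_code [seq l == k | l <- iota 0 n] | k <- iota 0 n & nth false m k].

(* Up to translation of the family, [m] marks the columns in which a member may
   be flipped; the search starts from this member and its flipped versions. *)
Definition star_search n t d :=
  lazy_all (fun m => if d <= count id m then
     let forced := star_codes n m in
     force forced [::]
       [seq x <- map (cons false) (bitseqs n.-1) | x \notin forced]
       (t - size forced) else true)
  (bitseqs n).

(** * Soundness of the search *)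

Section Search.
Variable P : pred (seq bool).
Hypothesis admissible4P : forall a b c d, P a -> P b -> P c -> P d -> admissible4 a b c d.

Lemma compatP fam x y : all P fam -> P x -> P y -> compat fam x y.
Proof.
move=> /allP Pfam Px Py; rewrite /compat lazy_allE; apply/allP => a aF.
by rewrite lazy_allE; apply/allP => b bF; apply: admissible4P => //; apply: Pfam.
Qed.

Lemma count_compat fam x s : all P fam -> P x ->
  count P [seq y <- s | compat fam x y] = count P s.
Proof.
move=> Pfam Px; rewrite count_filter; apply: eq_count => y /=.
by case Py : (P y); rewrite //= compatP.
Qed.

Lemma searchP fuel fam cands k :
  search fuel fam cands k -> all P fam -> count P cands < k.
Proof.
elim: fuel fam cands k => [|fuel IH] fam cands k /=; case: ltnP => [lt _ _|_ //].
- exact: leq_ltn_trans (count_size _ _) lt.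
- exact: leq_ltn_trans (count_size _ _) lt.
case: k cands => [//|k] [//|x r]; case: ifP => // h1 h2 Pfam.
rewrite /=; case Px : (P x) => /=; last exact: IH h2 Pfam.
by rewrite add1n ltnS -(count_compat r Pfam Px); apply: IH h1 _; rewrite /= Px.
Qed.

Lemma forceP forced fam cands k :
  force forced fam cands k -> all P forced -> all P fam -> count P cands < k.
Proof.
elim: forced fam cands => [|x f IH] fam cands /=.
  by move=> h _; apply: searchP h.
move=> h /andP[Px Pf] Pfam; rewrite -(count_compat cands Pfam Px).
have Pxfam : all P (x :: fam) by apply/andP.
apply: (IH _ _ _ Pf Pxfam); move: h; rewrite lazy_allE; case: allP => // -[] y yf.
by apply: compatP => //; move/allP: Pf; apply.
Qed.

End Search.

Lemma card_half n (F : {set {ffun 'I_n -> bool}}) i b : admissible F ->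
  #|F| = 2 * #|[set A in F | A i == b]|.
Proof.
move=> [negF _]; rewrite -(cardsID [set A : {ffun 'I_n -> bool} | A i == b] F).
have -> : F :&: [set A : {ffun 'I_n -> bool} | A i == b] = [set A in F | A i == b].
  by apply/setP => A; rewrite !inE.
rewrite mul2n -addnn; congr (_ + _).
rewrite -(card_imset _ (can_inj (@neg_rowK n))); congr #|pred_of_set _|.
apply/setP => A; apply/imsetP/setIdP => [[B /setDP[BF +] ->]|[AF Ai]].
  by rewrite inE neg_rowE negF //; case: (B i) b => -[].
exists (neg_row A); rewrite ?neg_rowK // !inE negF // neg_rowE -(eqP Ai).
by case: (A i).
Qed.

(** * Families translated by a member *)

Section Base.
Variables (n : nat) (F : {set {ffun 'I_n.+1 -> bool}}).
Hypothesis admF : admissible F.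
Variable A : {ffun 'I_n.+1 -> bool}.
Implicit Types B : {ffun 'I_n.+1 -> bool}.

(** Translation by [A] turns [A] into the zero code, and the rows obtained by flipping one entry of
    [A] into the unit codes. *)
Definition code B := [seq A k (+) B k | k <- enum 'I_n.+1].

Definition coded : pred (seq bool) := mem [seq code B | B in F].

Lemma codedP s : reflect (exists2 B, B \in F & s = code B) (coded s).
Proof. exact: imageP. Qed.

Lemma code_inj : injective code.
Proof.
move=> B C /eq_in_map E; apply/ffunP => k.
have := E k (mem_enum _ _).
by case: (A k) (B k) (C k) => -[] [].
Qed.

Lemma coded_admissible4 a b c d : coded a -> coded b -> coded c -> coded d -> admissible4 a b c d.
Proof.
move=> /codedP[B1 F1 ->] /codedP[B2 F2 ->] /codedP[B3 F3 ->] /codedP[B4 F4 ->].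
have -> : admissible4 (code B1) (code B2) (code B3) (code B4) =
    ~~ hadamard_cols true (cols4 (code B1) (code B2) (code B3) (code B4))
    && ~~ hadamard_cols false (cols4 (code B1) (code B2) (code B3) (code B4)).
  by rewrite /admissible4; case: ifP.
rewrite /code /cols4 !zip_map -map_comp.
rewrite (eq_map (g := fun k => (B1 k (+) B2 k, B1 k (+) B3 k, parity4 B1 B2 B3 B4 k)));
  last first.
  move=> k /=; rewrite /parity4.
  by case: (A k) (B1 k) (B2 k) (B3 k) (B4 k) => -[] [] [] [].
suff nohit p : ~~ hadamard_cols p [seq (B1 k (+) B2 k, B1 k (+) B3 k, parity4 B1 B2 B3 B4 k) |
    k <- enum 'I_n.+1] by rewrite !nohit.
rewrite /hadamard_cols filter_map -map_comp size_map.
set K := [seq k <- _ | _]; case: ifP => // K5; apply/negP => /allP H.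
have {}H x y : exists2 k, k \in K &
    (B1 k (+) B2 k = x) /\ (B1 k (+) B3 k = y).
  have /mapP[k kK [-> ->]] : (x, y) \in
      [seq (B1 k (+) B2 k, B1 k (+) B3 k) | k <- K].
    by apply: H; case: x; case: y; rewrite !inE eqxx ?orbT.
  by exists k.
have [ff ffK [ff1 ff2]] := H false false.
have [ft ftK [ft1 ft2]] := H false true.
have [tf tfK [tf1 tf2]] := H true false.
have [tt' ttK [tt1 tt2]] := H true true.
pose j (x y : bool) := if x then (if y then tt' else tf) else (if y then ft else ff).
(* More than four columns of parity [p] leave one outside the four chosen ones, against
   admissibility. *)
have [k kK kj] : exists2 k, k \in K & k \notin [:: ff; ft; tf; tt'].
  apply/hasP; apply: contraTT K5; rewrite -leqNgt => /hasPn N.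
  apply: (@uniq_leq_size _ K [:: ff; ft; tf; tt']).
    by rewrite filter_uniq ?enum_uniq.
  by move=> k /N; rewrite negbK.
have parK l : l \in K -> parity4 B1 B2 B3 B4 l = p.
  by rewrite mem_filter => /andP[/eqP].
have [|||x [y E]] := admF.2 B1 B2 B3 B4 j k F1 F2 F3 F4.
- by case=> -[].
- by case=> -[].
- by case=> -[]; rewrite !parK.
move: kj; rewrite E; move: x y {E}.
by case=> -[]; rewrite !inE eqxx ?orbT.
Qed.

Lemma coded_negb s : coded s -> coded (map negb s).
Proof.
move=> /codedP[B BF ->]; apply/codedP; exists (neg_row B); first exact: admF.1.
by rewrite -map_comp; apply: eq_map => k; rewrite /= neg_rowE addbN.
Qed.

Lemma card_coded :
  #|F| <= 2 * count coded (map (cons false) (bitseqs n)).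
Proof.
rewrite (card_half ord0 (A ord0) admF).
rewrite leq_mul2l /= cardE -(size_map code) -size_filter.
apply: uniq_leq_size; first by rewrite map_inj_uniq ?enum_uniq //; apply: code_inj.
move=> s /mapP[B]; rewrite mem_enum inE => /andP[BF /eqP BA] ->.
rewrite mem_filter; apply/andP; split; first by apply/codedP; exists B.
rewrite /code enum_ordSl /= BA addbb mem_map; last exact: cons_inj.
by rewrite mem_bitseqs size_map size_map size_enum_ord.
Qed.

(** The mask [m] of the free columns of [A] is among those enumerated, and its star codes all come
    from [F]. The search then bounds the codes starting with [false], one for each opposite pair of
    rows. *)
Lemma star_bound t d :
  star_search n.+1 t d -> A \in F ->
  d <= #|[set i | set_col i (~~ A i) A \in F]| -> #|F| < 2 * t.
Proof.
rewrite /star_search lazy_allE => /allP H AF dN.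
pose m := [seq set_col i (~~ A i) A \in F | i <- enum 'I_n.+1].
have cm : count id m = #|[set i | set_col i (~~ A i) A \in F]|.
  rewrite cardsE cardE count_map -size_filter [X in filter _ X]enumT.
  by rewrite [in RHS]/enum_mem; congr size; apply: eq_filter.
have := H m; rewrite mem_bitseqs size_map size_enum_ord eqxx => /(_ isT).
rewrite cm dN -[n.+1.-1]/n; set forced := star_codes _ _; move=> hforce.
have Pforced : all coded forced.
  rewrite /forced /star_codes; apply/andP; split.
    apply/codedP; exists A => //; rewrite /code.
    rewrite (eq_map (g := fun=> false)) => [|k]; last by rewrite addbb.
    have E (r : seq 'I_n.+1) : [seq false | _ <- r] = nseq (size r) false.
      by elim: r => //= _ r ->.
    by rewrite E size_enum_ord.
  apply/allP => s /mapP[k]; rewrite mem_filter => /andP[mk].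
  rewrite mem_iota => /andP[_]; rewrite add0n => kn ->.
  pose k' := Ordinal kn.
  have : coded [seq l == k | l <- iota 0 n.+1].
    apply/codedP; exists (set_col k' (~~ A k') A).
      by move: mk; rewrite /m (nth_map k') ?size_enum_ord // -[k]/(val k') nth_ord_enum.
    rewrite -val_enum_ord /code -map_comp; apply: eq_map => l /=.
    rewrite set_colE -val_eqE /=; case: eqP => [E|]; last by rewrite addbb.
    have -> : l = k' by apply: val_inj.
    by rewrite addbN addbb.
  by rewrite /normal_code; case: ifP => // _; apply: coded_negb.
have cnt := forceP coded_admissible4 hforce Pforced isT.
apply: leq_ltn_trans card_coded _; rewrite ltn_pmul2l //.
set pts := map _ _ in cnt *.
(* The forced codes contribute at most [size forced], and the search leaves fewer than
   [t - size forced] others. *)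
rewrite -(permP (permEl (perm_filterC (mem forced) pts))) count_cat.
have : count coded [seq x <- pts | mem forced x] <= size forced.
  apply: leq_trans (count_size _ _) _; apply: uniq_leq_size.
    by rewrite filter_uniq ?(map_inj_uniq (@cons_inj _ _)) ?uniq_bitseqs.
  by move=> x; rewrite mem_filter => /andP[].
by move: cnt; rewrite ltn_subRL => cnt le; apply: leq_ltn_trans cnt; rewrite leq_add2r.
Qed.

End Base.

Lemma edgesE n (F : {set {ffun 'I_n -> bool}}) i A : A \in F ->
  (A \in edges i F) = (set_col i (~~ A i) A \in F).
Proof.
move=> AF; rewrite inE; have := set_col_id i A.
by case: (A i) => ->; rewrite AF ?andbT.
Qed.

(* Double counting of the pairs (row, free column). *)
Lemma exists_large_degree n (F : {set {ffun 'I_n -> bool}}) d e :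
  (forall i, e <= #|edges i F|) -> d * #|F| < n * e ->
  exists2 A, A \in F & d < #|[set i | set_col i (~~ A i) A \in F]|.
Proof.
move=> He lt; have [/exists_inP[A AF H]|N] :=
  boolP [exists A in F, d < #|[set i | set_col i (~~ A i) A \in F]|]; first by exists A.
have sum_le : n * e <= \sum_(i < n) #|edges i F|.
  by rewrite -[n in n * e]card_ord -sum_nat_const leq_sum.
suff : \sum_(i < n) #|edges i F| <= d * #|F|.
  by move=> h; have := leq_trans lt (leq_trans sum_le h); rewrite ltnn.
have -> : \sum_(i < n) #|edges i F| =
    \sum_(i < n) \sum_(A in F | A \in edges i F) 1.
  apply: eq_bigr => i _; rewrite -sum1_card; apply: eq_bigl => A.
  by apply/idP/andP => [AD|[]//]; rewrite (edges_sub AD).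
rewrite (exchange_big_dep (mem F)) /=; last by move=> i A _ /andP[].
rewrite mulnC -sum_nat_const; apply: leq_sum => A AF.
rewrite sum1dep_card leqNgt; apply: contra N => H.
apply/exists_inP; exists A => //; apply: leq_trans H _.
apply: subset_leq_card; apply/subsetP => i; rewrite in_set => /andP[_].
by rewrite edgesE // in_set.
Qed.

Lemma card_admissible5 (F : {set {ffun 'I_5 -> bool}}) :
  admissible F -> #|F| <= 20.
Proof.
move=> admF; rewrite leqNgt; apply/negP => big.
(* Deleting a column leaves at most [2 ^ 4 = 16] rows, so each column has at least [2 * #|F| - 32]
   free rows. For [#|F| > 20] the average number of free columns per row then exceeds 2. *)
have [i||A AF dA] := @exists_large_degree _ F 2 (2 * #|F| - 32).
- rewrite leq_subLR (card_del_col i F) leq_add2r -[32]/(2 * 16) leq_mul2l /=.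
  by rewrite (leq_trans (max_card _)) // card_ffun card_bool card_ord.
- lia.
have := star_bound admF (t := 11) (d := 3) _ AF dA.
have -> : star_search 5 11 3 by vm_compute.
(* The search gives [#|F| < 22], and [#|F|] is even. *)
by move=> /(_ isT); have := card_half ord0 true admF; lia.
Qed.

Lemma card_admissible6 (F : {set {ffun 'I_6 -> bool}}) :
  admissible F -> #|F| <= 26.
Proof.
move=> admF; rewrite leqNgt; apply/negP => big.
(* The same count with at most 20 rows left on five columns: for [#|F| > 26] some row has at least 4
   free columns. The search then gives [#|F| < 28], and parity concludes. *)
have [i||A AF dA] := @exists_large_degree _ F 3 (2 * #|F| - 40).
- rewrite leq_subLR (card_del_col i F) leq_add2r.
  by rewrite -[40]/(2 * 20) leq_mul2l; apply: card_admissible5; apply: admissible_del_col.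
- lia.
have := star_bound admF (t := 14) (d := 4) _ AF dA.
have -> : star_search 6 14 4 by vm_compute.
by move=> /(_ isT); have := card_half ord0 true admF; lia.
Qed.

(** Induction from [26 + 22 = 8 * 6]: deleting a column with at most 16 free rows loses at most 8
    rows. *)
Lemma card_admissible n (F : {set {ffun 'I_n -> bool}}) :
  6 <= n -> admissible F -> #|F| + 22 <= 8 * n.
Proof.
elim: n F => [//|n IH] F; rewrite leq_eqVlt => /predU1P[n6|n6] admF.
  have {}n6 : n = 5 by lia.
  by subst n; have := card_admissible6 admF; rewrite -(leq_add2r 22).
have [i few] := few_edges admF n6.
have step a b c : 2 * a = 2 * b + c -> c <= 16 -> b + 22 <= 8 * n ->
  a + 22 <= 8 * n.+1 by lia.
exact: step (card_del_col i F) few (IH _ n6 (admissible_del_col i admF)).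
Qed.

From mathcomp Require Import all_order all_algebra.
From mathcomp Require Import boolp classical_sets functions cardinality reals.
From mathcomp Require Import ring lra.

Import Order.TTheory GRing.Theory Num.Theory.

Local Open Scope classical_set_scope.
Local Open Scope card_scope.
Local Open Scope ring_scope.

(** * Minimal vectors *)

Section Span.
Variables (R : realType) (E : vectType R).
Implicit Types (X : seq E) (v w : E).

Lemma int_span0 X : int_span X 0.
Proof. by exists 0; rewrite big1 // => i _; rewrite ffunE mulr0z. Qed.

Lemma int_spanD X v w : int_span X v -> int_span X w -> int_span X (v + w).
Proof.
move=> [a ->] [b ->]; exists (a + b); rewrite -big_split /=.
by apply: eq_bigr => i _; rewrite ffunE mulrzDr.
Qed.

Lemma int_spanN X v : int_span X v -> int_span X (- v).
Proof.
move=> [a ->]; exists (- a); rewrite -sumrN.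
by apply: eq_bigr => i _; rewrite ffunE mulrNz.
Qed.

Lemma int_spanMz X v k : int_span X v -> int_span X (v *~ k).
Proof.
move=> [a ->]; exists [ffun i => a i * k]; rewrite mulrz_suml.
by apply: eq_bigr => i _; rewrite ffunE mulrzA.
Qed.

Lemma int_span_scalar X (f : E -> R) v : scalar f ->
  {in X, forall x, f x \is a Num.int} -> int_span X v -> f v \is a Num.int.
Proof.
move=> linf intf [a ->].
pose flM := GRing.isLinear.Build _ _ _ _ f linf.
pose fL : {scalar E} := HB.pack f flM.
rewrite -[f _]/(fL _) raddf_sum rpred_sum // => i _.
rewrite raddfMz rpredMz //; apply: intf; exact: mem_nth.
Qed.

Lemma free_cons_scalar X (f : E -> R) v : scalar f ->
  {in X, forall x, f x = 0} -> f v != 0 -> free X -> free (v :: X).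
Proof.
move=> linf f0 fv freeX; rewrite free_cons freeX andbT.
pose flM := GRing.isLinear.Build _ _ _ _ f linf.
pose fL : {scalar E} := HB.pack f flM.
apply: contra fv; rewrite -[X]/(val (in_tuple X)) => /coord_span ->.
rewrite -[f _]/(fL _) raddf_sum big1 // => i _.
have := linf (coord (in_tuple X) i v) X`_i 0; rewrite addr0 => fZ.
apply: etrans fZ _; by rewrite -[f 0]/(fL 0) raddf0 f0 ?mulr0 ?addr0 // mem_nth.
Qed.

(** Pigeonhole: index at most 2 puts two of three lattice vectors in the same coset. *)
Lemma three_cosets (L : set E) X u v w :
  cosets L (int_span X) #<= `I_2 -> L u -> L v -> L w ->
  [\/ int_span X (u - v), int_span X (u - w) | int_span X (v - w)].
Proof.
move=> /pcard_leP /injfunPex[f ran inj] Lu Lv Lw.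
pose c x := [set x + y | y in int_span X].
have cL x : L x -> c x \in cosets L (int_span X).
  by move=> Lx; rewrite inE; exists x.
have lt2 x : L x -> (f (c x) < 2)%N by move=> /cL; rewrite inE => /ran.
have eqc x y : L x -> L y -> f (c x) = f (c y) -> int_span X (x - y).
  move=> Lx Ly /inj E'; have : c x x.
    by exists 0; [exact: int_span0 | rewrite addr0].
  rewrite E' ?cL // => -[z zX <-]; by rewrite addrC addKr.
move: (lt2 _ Lu) (lt2 _ Lv) (lt2 _ Lw) (eqc _ _ Lu Lv) (eqc _ _ Lu Lw) (eqc _ _ Lv Lw).
case: (f (c u)) => [|[|//]]; case: (f (c v)) => [|[|//]];
  case: (f (c w)) => [|[|//]] _ _ _ h1 h2 h3;
  by [apply: Or31; apply: h1 | apply: Or32; apply: h2 | apply: Or33; apply: h3].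
Qed.

End Span.

Lemma int_norm_lt1 (R : realType) (x : R) : x \is a Num.int -> `|x| < 1 -> x = 0.
Proof.
move=> /intrP[k ->]; rewrite -intr_norm -[1]/(1%:~R) ltr_int.
by case: k => -[|k] //=; lia.
Qed.

(** * Coordinates in a basis *)

Section Frame.
Variables (R : realType) (E : vectType R) (n : nat) (e : n.-tuple E).
Hypothesis basE : basis_of {:E} e.
Implicit Types (v w : E) (i j : 'I_n).

Local Notation c := (coord e).

Lemma frame_coord v : v = \sum_i c i v *: e`_i.
Proof. exact: coord_basis (memvf v). Qed.

Lemma coord_inj v w : (forall i, c i v = c i w) -> v = w.
Proof.
move=> H; rewrite (frame_coord v) (frame_coord w).
by apply: eq_bigr => i _; rewrite H.
Qed.

Lemma coord_frame i j : c i e`_j = (i == j)%:R.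
Proof. by rewrite coord_free ?(basis_free basE) // eq_sym. Qed.

Lemma coord_mem x : x \in (e : seq E) -> exists i, x = e`_i.
Proof.
by move=> /tnthP[i ->]; exists i; rewrite (tnth_nth 0).
Qed.

Lemma int_spanP v :
  int_span e v <-> forall i, c i v \is a Num.int.
Proof.
split=> [ev i|H].
  apply: (@int_span_scalar _ _ e (c i)) ev => [|x /coord_mem[j ->]].
    exact: linearP.
  by rewrite coord_frame; case: eqP.
have {}H i : exists k : int, c i v = k%:~R by exact/intrP.
have [k Hk] := choice H.
exists [ffun i : 'I_(size e) => k (cast_ord (size_tuple e) i)].
rewrite [LHS]frame_coord (reindex (cast_ord (size_tuple e))) /=; last first.
  by exists (cast_ord (esym (size_tuple e))) => i _; rewrite ?cast_ordK ?cast_ordKV.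
apply: eq_bigr => i _; rewrite ffunE Hk.
by rewrite -scaler_int.
Qed.

Lemma int_span_sub (L : set E) v : is_lattice L ->
  (forall i, L e`_i) -> int_span e v -> L v.
Proof.
move=> [B _ ->] Le /int_spanP H; rewrite (frame_coord v).
elim/big_ind: _ => [||i _]; [exact: int_span0 | exact: int_spanD |].
have /intrP[k ->] := H i; rewrite scaler_int.
exact: int_spanMz (Le i).
Qed.

Definition frame_comb (a : 'I_n -> R) := \sum_i a i *: e`_i.

Lemma coord_frame_comb a i : c i (frame_comb a) = a i.
Proof. by rewrite coord_sum_free // (basis_free basE). Qed.

End Frame.

(** * Minimal vectors for maximal index 2 and length n *)

Section MinVectors.
Variables (R : realType) (E : vectType R) (dot : {dot E for (@idfun R)}).
Variables (L : set E) (n : nat) (e : n.-tuple E) (y : E).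
Hypotheses (basE : basis_of {:E} e) (lattL : is_lattice L).
Hypothesis minE : [set` (e : seq E)] `<=` min_vectors dot L.
Hypotheses (Ly : L y) (sumE : \sum_(x <- e) x = y *+ 2).
Hypothesis indexL : forall X, min_frame dot L X -> cosets L (int_span X) #<= `I_2.
Hypothesis lengthL : forall X, even_min_set dot L X -> (n <= size X)%N.
Hypothesis n_gt0 : (0 < n)%N.
Implicit Types (v w : E) (i j : 'I_n) (A B C D : {ffun 'I_n -> bool}).

Local Notation c := (coord e).

Lemma min_frame_vector i : min_vectors dot L e`_i.
Proof. by apply: minE; rewrite /= mem_nth // size_tuple. Qed.

Lemma lattice_frame_vector i : L e`_i.
Proof. by have [] := min_frame_vector i. Qed.

Lemma latticeD v w : L v -> L w -> L (v + w).
Proof. by case: lattL => B _ ->; apply: int_spanD. Qed.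

Lemma latticeN v : L v -> L (- v).
Proof. by case: lattL => B _ ->; apply: int_spanN. Qed.

Lemma lattice0 : L 0.
Proof. by case: lattL => B _ ->; apply: int_span0. Qed.

Lemma min_vectorsN x : min_vectors dot L x -> min_vectors dot L (- x).
Proof.
move=> [Lx x0 minx]; split; [exact: latticeN | by rewrite oppr_eq0 |].
by move=> z Lz z0; rewrite linearNl linearNr opprK; apply: minx.
Qed.

Lemma coord_half i : c i y = 2^-1.
Proof.
have : c i (y *+ 2) = 1.
  rewrite -sumE (big_nth 0) size_tuple big_mkord linear_sum (bigD1 i) //= big1.
    by rewrite coord_frame // eqxx addr0.
  by move=> j ji; rewrite coord_frame // eq_sym (negbTE ji).
by rewrite linearMn /= => H; lra.
Qed.

Lemma lattice_int v : (forall i, c i v \is a Num.int) -> L v.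
Proof.
move=> H; apply: (int_span_sub basE lattL lattice_frame_vector).
exact/(int_spanP basE).
Qed.

Lemma half_notin_int : ~ (2^-1 : R) \is a Num.int.
Proof.
by move=> /int_norm_lt1; rewrite ger0_norm; first move=> /(_ _); lra.
Qed.

(** Two of [v], [y] and [0] are congruent modulo the span of [e]; these are not [y] and [0], since
    [y] has coordinates one half. *)
Lemma lattice_cosets v : L v ->
  (forall i, c i v \is a Num.int) \/ (forall i, c i v - 2^-1 \is a Num.int).
Proof.
move=> Lv; have frameE : min_frame dot L e.
  split=> //; first exact: basis_free basE.
  by rewrite (size_basis basE) size_tuple.
have := three_cosets (indexL frameE) Lv Ly lattice0; rewrite !subr0.
case=> /(int_spanP basE) H.
- by right=> i; have := H i; rewrite linearB /= coord_half.
- by left.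
- by have := H (Ordinal n_gt0); rewrite coord_half => /half_notin_int.
Qed.

Lemma free_frame_sub (s : seq 'I_n) : uniq s -> free [seq e`_i | i <- s].
Proof.
elim: s => [|i s IH] /=; first by rewrite nil_free.
move=> /andP[iss us]; apply: (@free_cons_scalar _ _ _ (c i)); last exact: IH.
- exact: linearP.
- move=> _ /mapP[j js ->]; rewrite coord_frame //.
  by case: eqVneq js iss => // -> ->.
- by rewrite coord_frame // eqxx oner_eq0.
Qed.

(* Replacing [e_i] by [x], the cosets of [0], [y] and [e_i] are distinct if
   [`|c i x| > 1]. *)
Lemma coord_norm_le1 x i : min_vectors dot L x -> `|c i x| <= 1.
Proof.
move=> minx; rewrite leNgt; apply/negP => gt1.
have x0 : c i x != 0 by rewrite -normr_gt0; apply: lt_trans gt1.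
pose X := x :: [seq e`_j | j <- enum 'I_n & j != i].
have frameX : min_frame dot L X.
  split.
  - move=> z; rewrite /= inE => /orP[/eqP -> //|/mapP[j _ ->]].
    exact: min_frame_vector.
  - apply: (@free_cons_scalar _ _ _ (c i)) => //; first exact: linearP.
      move=> z /mapP[j]; rewrite mem_filter => /andP[ji _] ->.
      by rewrite coord_frame // eq_sym (negbTE ji).
    by apply: free_frame_sub; rewrite filter_uniq ?enum_uniq.
  - rewrite /= size_map (size_basis basE) size_filter.
    have := count_predC (pred1 i) (enum 'I_n).
    by rewrite count_uniq_mem ?enum_uniq // mem_enum size_enum_ord.
(* The functional [c i], scaled to be 1 at [x], vanishes on the other generators and so is integral
   on their span. *)
have intX v : int_span X v -> c i v / c i x \is a Num.int.
  apply: (@int_span_scalar _ _ _ (fun v => c i v / c i x)).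
    by move=> k u w /=; rewrite linearP /= mulrDl mulrA.
  move=> z; rewrite inE => /orP[/eqP ->|/mapP[j]]; first by rewrite divff.
  rewrite mem_filter => /andP[ji _] ->.
  by rewrite coord_frame // eq_sym (negbTE ji) mul0r.
have small t : t != 0 -> `|t| <= 1 -> t / c i x \is a Num.int -> False.
  move=> t0 t1 /int_norm_lt1; rewrite normrM normfV ltr_pdivrMr ?normr_gt0 //.
  rewrite mul1r => /(_ (le_lt_trans t1 gt1))/eqP.
  by rewrite mulf_eq0 (negbTE t0) invr_eq0 (negbTE x0).
(* The differences of [y], [e_i] and [0] have [i]-th coordinates -1/2, 1/2 and 1, too small to be
   nonzero multiples of [c i x]. *)
have := three_cosets (indexL frameX) Ly (lattice_frame_vector i) lattice0.
rewrite !subr0; case=> /intX; apply: small.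
all: rewrite ?linearB /= ?coord_half ?coord_frame // ?eqxx /=.
all: by [lra | rewrite ?normr1 //; rewrite ler_norml; lra | apply/eqP; lra].
Qed.

Lemma even_set_size X (z : E) :
  X != [::] -> [set` X] `<=` min_vectors dot L -> free X ->
  \sum_(x <- X) x = z *+ 2 -> L z -> (n <= size X)%N.
Proof.
by move=> X0 minX freeX sumX Lz; apply: lengthL; split=> //; exists z.
Qed.

(** The coordinates are 0, 1 or -1. If the support [S] had two elements or more, [x] and the [e_j]
    with [j] outside [S] would be independent, with a sum whose coordinates are all 1 or -1. Half of
    this sum is congruent to [y], so they form an even set with fewer than [n] elements. *)
Lemma min_int_coord x : min_vectors dot L x ->
  (forall i, c i x \is a Num.int) -> exists i, x = e`_i \/ x = - e`_i.
Proof.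
move=> minx intx.
have cx i : c i x \in [:: 0; 1; -1].
  have := coord_norm_le1 i minx; have /intrP[k ->] := intx i.
  rewrite -intr_norm -[1 in X in _ <= X]/(1%:~R) ler_int.
  by case: k => [[|[|k]]|[|k]] //= _; rewrite !inE ?eqxx ?orbT.
have [_ x0 _] := minx.
pose S := finset (fun i => c i x != 0).
have [i iS] : exists i, i \in S.
  apply/existsP; apply: contraNT x0; rewrite negb_exists => /forallP H.
  apply/eqP; apply: (coord_inj basE) => i; rewrite linear0.
  by have := H i; rewrite inE negbK => /eqP.
have [S1|] := leqP #|S| 1.
  have xE : x = c i x *: e`_i.
    apply: (coord_inj basE) => j; rewrite linearZ /= coord_frame //.
    have [->|ji] := eqVneq j i; first by rewrite mulr1.
    rewrite mulr0; apply/eqP; move: S1; rewrite leqNgt; apply: contraNT => cj.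
    by rewrite (cardsD1 i S) iS (cardsD1 j (S :\ i)) !inE ji cj.
  exists i; move: (cx i); rewrite !inE => /or3P[] /eqP E0.
  - by move: iS; rewrite inE E0 eqxx.
  - by left; rewrite xE E0 scale1r.
  - by right; rewrite xE E0 scaleN1r.
move=> S2.
pose X := x :: [seq e`_j | j <- enum (~: S)].
pose s := \sum_(z <- X) z.
have cs j : c j s = c j x + (j \notin S)%:R.
  rewrite /s big_cons linearD /= big_map linear_sum /=; congr (_ + _).
  have [jS|jS] := boolP (j \in S).
    rewrite big_seq big1 // => l; rewrite mem_enum inE => lS.
    by rewrite coord_frame //; case: eqVneq lS => // <-; rewrite jS.
  have jm : j \in enum (~: S) by rewrite mem_enum finset.in_setC.
  rewrite (bigD1_seq j jm) ?enum_uniq //= coord_frame // eqxx.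
  rewrite big1 ?addr0 // => l lj; by rewrite coord_frame // eq_sym (negbTE lj).
have : (n <= size X)%N.
  apply: (@even_set_size _ (2^-1 *: s)) => //.
  - move=> z; rewrite /= inE => /orP[/eqP -> //|/mapP[j _ ->]].
    exact: min_frame_vector.
  - apply: (@free_cons_scalar _ _ _ (c i)) => //; first exact: linearP.
    + move=> z /mapP[j]; rewrite mem_enum inE => jS ->.
      by rewrite coord_frame //; case: eqVneq jS => // <-; rewrite iS.
    + by move: iS; rewrite inE.
    + by apply: free_frame_sub; rewrite enum_uniq.
  - by rewrite -/s -scaler_nat scalerA divff ?scale1r ?pnatr_eq0.
  - have -> : 2^-1 *: s = y + (2^-1 *: s - y) by rewrite addrC subrK.
    apply: latticeD => //; apply: lattice_int => j.
    rewrite linearB linearZ /= coord_half cs inE negbK.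
    move: (cx j); rewrite !inE => /or3P[] /eqP ->; rewrite ?eqxx ?oner_eq0 ?oppr_eq0 ?oner_eq0 /=.
    + by rewrite add0r mulr1 subrr.
    + by rewrite addr0 mulr1 subrr.
    + by rewrite addr0 mulrN1 -opprD (_ : 2^-1 + 2^-1 = 1) ?rpredN ?rpred1 //; lra.
rewrite /= size_map -cardE; have := cardsC S; rewrite card_ord; lia.
Qed.

Definition half_sum A := frame_comb e (fun i => if A i then - 2^-1 else 2^-1).

Lemma coord_half_sum A i : c i (half_sum A) = if A i then - 2^-1 else 2^-1.
Proof. exact: coord_frame_comb. Qed.

Lemma half_sum_neg_row A : half_sum (neg_row A) = - half_sum A.
Proof.
apply: (coord_inj basE) => i; rewrite linearN /= !coord_half_sum neg_rowE.
by case: (A i); rewrite ?opprK.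
Qed.

Lemma min_half_coord x : min_vectors dot L x ->
  (forall i, c i x - 2^-1 \is a Num.int) -> exists A, x = half_sum A.
Proof.
move=> minx intx; exists [ffun i => c i x < 0].
apply: (coord_inj basE) => i; rewrite coord_half_sum ffunE.
have := coord_norm_le1 i minx; have /intrP[k Ek] := intx i.
have -> : c i x = 2^-1 + k%:~R by rewrite -Ek addrC subrK.
rewrite ler_norml => /andP[h1 h2].
have : (-2 < k)%R && (k < 1)%R.
  by apply/andP; split; rewrite -(ltr_int R) ?rmorphN /=; lra.
case: k {Ek} h1 h2 => [[|k]|[|k]] // h1 h2 _; last by rewrite ifT; lra.
by rewrite addr0 ifF //; lra.
Qed.

Definition half_min := finset (fun A => `[< min_vectors dot L (half_sum A) >]).

Lemma min_vectors_cases x : min_vectors dot L x ->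
  (exists i, x = e`_i \/ x = - e`_i) \/ exists2 A, A \in half_min & x = half_sum A.
Proof.
move=> minx; have [Lx _ _] := minx.
case: (lattice_cosets Lx) => H; first by left; apply: min_int_coord.
have [A xA] := min_half_coord minx H.
by right; exists A => //; rewrite inE -xA; apply/asboolP.
Qed.

Lemma half_minP A :
  reflect (min_vectors dot L (half_sum A)) (A \in half_min).
Proof. by rewrite inE; apply: asboolP. Qed.

(* Orthogonality of the Hadamard matrix provides dual functionals, whence the
   freeness needed to apply the length hypothesis. *)
Lemma hadamard_scalar A (j : bool -> bool -> 'I_n) :
  exists2 f : E -> R, scalar f & [/\
    forall l, (forall x y, l != j x y) -> f e`_l = 0,
    f (half_sum A) = 1 &
    forall B (u v : bool), u || v -> (forall x y, A (j x y) (+) B (j x y) = (u && x) (+) (v && y)) ->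
      f (half_sum B) = 0].
Proof.
have sum4 (g : bool -> bool -> R) : \sum_x \sum_z g x z =
    g true true + g true false + (g false true + g false false).
  by rewrite !big_bool.
pose s l : R := if A l then - 2^-1 else 2^-1.
exists (fun v => \sum_x \sum_y s (j x y) * c (j x y) v).
  move=> k v w /=; rewrite mulr_sumr -big_split; apply: eq_bigr => x _ /=.
  rewrite mulr_sumr -big_split; apply: eq_bigr => z _ /=.
  by rewrite linearP /= mulrDr mulrCA.
split.
- move=> l lj; rewrite big1 // => x _; rewrite big1 // => z _.
  by rewrite coord_frame // eq_sym (negbTE (lj _ _)) mulr0.
- rewrite sum4 !coord_half_sum // /s.
  by do 4 case: (A _); lra.
- move=> B u v uv AB; rewrite sum4 !coord_half_sum // /s.
  move: (AB true true) (AB true false) (AB false true) (AB false false) => {AB}.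
  move: uv; case: u; case: v => //= _;
  case: (A (j true true)); case: (A (j true false));
  case: (A (j false true)); case: (A (j false false));
  case: (B (j true true)) => //=; case: (B (j true false)) => //=;
  case: (B (j false true)) => //=; case: (B (j false false)) => //= *; lra.
Qed.

(* Otherwise the four half sums and the [e_l] with [l] of odd parity form an even
   set which misses column [k], hence has fewer than [n] elements. *)
Lemma even_config A B C D (j : bool -> bool -> 'I_n) k :
  A \in half_min -> B \in half_min ->
  C \in half_min -> D \in half_min ->
  (forall x y, A (j x y) (+) B (j x y) = x) ->
  (forall x y, A (j x y) (+) C (j x y) = y) ->
  (forall x y, parity4 A B C D (j x y) = false) -> parity4 A B C D k = false ->
  exists x y, k = j x y.
Proof.
move=> minA minB minC minD AB AC parj park.
have [/existsP[x /existsP[z /eqP ->]]|N] :=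
  boolP [exists x, exists z, k == j x z]; first by exists x, z.
have AD x z : A (j x z) (+) D (j x z) = x (+) z.
  have := parj x z; move: (AB x z) (AC x z); rewrite /parity4.
  by case: (A _) (B _) (C _) (D _) => -[] [] []; case: x; case: z.
have BC x z : B (j x z) (+) C (j x z) = x (+) z.
  have := parj x z; move: (AB x z) (AC x z); rewrite /parity4.
  by case: (A _) (B _) (C _) (D _) => -[] [] []; case: x; case: z.
have BD x z : B (j x z) (+) D (j x z) = z.
  have := parj x z; move: (AB x z) (AC x z); rewrite /parity4.
  by case: (A _) (B _) (C _) (D _) => -[] [] []; case: x; case: z.
have CD x z : C (j x z) (+) D (j x z) = x.
  have := parj x z; move: (AB x z) (AC x z); rewrite /parity4.
  by case: (A _) (B _) (C _) (D _) => -[] [] []; case: x; case: z.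
pose J := finset (fun l => parity4 A B C D l).
have Jj l : l \in J -> forall x z, l != j x z.
  rewrite inE => lJ x z; apply: contraTneq lJ => ->; by rewrite parj.
pose h := half_sum.
pose X := [:: h A; h B; h C; h D] ++ [seq e`_l | l : 'I_n <- enum J].
(* The four distinct columns [T], the odd columns [J] and the column [k] are disjoint. *)
have small : (size X < n)%N.
  rewrite /= size_map -cardE.
  have j_inj : injective (fun t : bool * bool => j t.1 t.2).
    move=> [x z] [x' z'] /= E0; congr (_, _).
      by rewrite -(AB x z) -(AB x' z') E0.
    by rewrite -(AC x z) -(AC x' z') E0.
  pose T := (fun t : bool * bool => j t.1 t.2) @: finset predT.
  have cT : #|T| = 4%N by rewrite card_imset // cardsT card_prod !card_bool.
  have TJ0 : #|T :&: J| = 0%N.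
    apply: eq_card0 => l; rewrite !inE.
    by apply/negP => /andP[/imsetP[t _ ->]]; rewrite parj.
  have kTJ : k \notin T :|: J.
    rewrite !inE park orbF; apply/imsetP => -[t _ kt]; case/negP: N.
    by apply/existsP; exists t.1; apply/existsP; exists t.2; rewrite kt.
  have := max_card (mem (k |: (T :|: J))).
  by rewrite cardsU1 kTJ cardsU TJ0 subn0 cT card_ord.
have freeX : free X.
  have [fA linA [A0 A1 AX]] := hadamard_scalar A j.
  have [fB linB [B0 B1 BX]] := hadamard_scalar B j.
  have [fC linC [C0 C1 CX]] := hadamard_scalar C j.
  have [fD linD [D0 D1 DX]] := hadamard_scalar D j.
  have memJ z : z \in [seq e`_l | l : 'I_n <- enum J] ->
      exists2 l, (forall x z, l != j x z) & z = e`_l.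
    by move=> /mapP[l]; rewrite mem_enum => /Jj lJ ->; exists l.
  apply: (free_cons_scalar linA); rewrite ?A1 ?oner_eq0 //.
    move=> z; rewrite !inE => /or4P[/eqP ->|/eqP ->|/eqP ->|/memJ[l lj ->]].
    - by apply: (AX _ true false) => // x x'; rewrite AB addbF.
    - by apply: (AX _ false true) => // x x'; rewrite AC.
    - by apply: (AX _ true true) => // x x'; rewrite AD.
    - exact: A0.
  apply: (free_cons_scalar linB); rewrite ?B1 ?oner_eq0 //.
    move=> z; rewrite !inE => /or3P[/eqP ->|/eqP ->|/memJ[l lj ->]].
    - by apply: (BX _ true true) => // x x'; rewrite BC.
    - by apply: (BX _ false true) => // x x'; rewrite BD.
    - exact: B0.
  apply: (free_cons_scalar linC); rewrite ?C1 ?oner_eq0 //.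
    move=> z; rewrite !inE => /orP[/eqP ->|/memJ[l lj ->]].
    - by apply: (CX _ true false) => // x x'; rewrite CD addbF.
    - exact: C0.
  apply: (free_cons_scalar linD); rewrite ?D1 ?oner_eq0 //.
    by move=> z /memJ[l lj ->]; apply: D0.
  by apply: free_frame_sub; rewrite enum_uniq.
pose s := \sum_(z <- X) z.
have cs l : c l s = c l (h A) + c l (h B) + c l (h C) + c l (h D) + (l \in J)%:R.
  rewrite /s !big_cons !linearD /= !addrA; congr (_ + _).
  rewrite big_map linear_sum /=.
  have [lJ|lJ] := boolP (l \in J).
    have lm : l \in enum J by rewrite mem_enum.
    rewrite (bigD1_seq l lm) ?enum_uniq //= coord_frame // eqxx.
    by rewrite big1 ?addr0 // => i il; rewrite coord_frame // eq_sym (negbTE il).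
  rewrite big_seq big1 // => i; rewrite mem_enum => iJ.
  by rewrite coord_frame //; case: eqVneq lJ => // ->; rewrite iJ.
have : (n <= size X)%N; last by rewrite leqNgt small.
apply: (even_set_size (z := 2^-1 *: s)) => //.
- move=> z; rewrite /= !inE => /or4P[/eqP ->|/eqP ->|/eqP ->|]; try exact/half_minP.
  move=> /orP[/eqP ->|/mapP[l _ ->]]; first exact/half_minP.
  exact: min_frame_vector.
- by rewrite -/s -scaler_nat scalerA divff ?scale1r ?pnatr_eq0.
(* Four entries 1/2 or -1/2 add up to an integer with the parity of the number of minus signs, so
   adding 1 on [J] makes every coordinate of [s] even. *)
- apply: lattice_int => l; rewrite linearZ /= cs inE.
  rewrite /h !coord_half_sum // /parity4.
  have half_int (m : int) t : t = 2 * m%:~R :> R -> 2^-1 * t \is a Num.int.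
    by move=> ->; rewrite mulrA mulVf ?pnatr_eq0 // mul1r.
  case: (A l); case: (B l); case: (C l); case: (D l) => /=;
    by [apply: (half_int 0); lra | apply: (half_int 1); lra | apply: (half_int (-1)); lra].
Qed.

(** Negating [D] reverses all parities, which reduces the odd case to the even one. *)
Lemma admissible_half_min : admissible (half_min).
Proof.
split=> [A /half_minP minA|A B C D j k minA minB minC minD AB AC parj].
  apply/half_minP; rewrite half_sum_neg_row //; exact: min_vectorsN.
have [pk|pk] := boolP (parity4 A B C D k); last first.
  apply: (even_config minA minB minC minD AB AC); last exact: negbTE.
  by move=> x z; rewrite parj (negbTE pk).
have parN l : parity4 A B C (neg_row D) l = ~~ parity4 A B C D l.
  by rewrite /parity4 neg_rowE addbN.
have minD' : neg_row D \in half_min.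
  by apply/half_minP; rewrite half_sum_neg_row //; apply: min_vectorsN => //; apply/half_minP.
apply: (even_config minA minB minC minD' AB AC); last by rewrite parN pk.
by move=> x z; rewrite parN parj pk.
Qed.

(** Besides the [n] pairs of frame vectors, each pair comes from one row whose entry in column [i0]
    is [false]. These rows are half of [half_min], hence at most [4 * n - 11]. *)
Lemma card_min_pairs s : min_pairs dot L #= `I_s ->
  (6 <= n)%N -> (s + 11 <= 5 * n)%N.
Proof.
move=> card_s n6; pose i0 := Ordinal n_gt0.
pose F0 := finset (fun A => (A \in half_min) && (A i0 == false)).
pose pairs : seq (set E) := [seq [set e`_i; - e`_i] | i <- enum 'I_n] ++
  [seq [set half_sum A; - half_sum A] | A <- enum F0].
have le_s : (s <= n + #|F0|)%N.
  have size_pairs : size pairs = (n + #|F0|)%N.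
    by rewrite size_cat size_map size_enum_ord size_map -cardE.
  rewrite -card_le_II -size_pairs.
  have le1 : `I_s #<= min_pairs dot L by move: card_s; rewrite card_eq_le => /andP[].
  have le2 : min_pairs dot L #<= (nth set0 pairs @` `I_(size pairs)).
    apply: subset_card_le => _ [x minx <-].
    have [k kp <-] : exists2 k, (k < size pairs)%N & nth set0 pairs k = [set x; - x].
      have pairN (z : E) : [set - z; - - z] = [set z; - z] by rewrite opprK classical_sets.setUC.
      case: (min_vectors_cases minx).
        move=> [i xi]; exists i; first by rewrite size_pairs ltn_addr.
        rewrite nth_cat size_map size_enum_ord ltn_ord.
        rewrite (nth_map i) ?size_enum_ord // nth_ord_enum.
        by case: xi => ->; rewrite ?pairN.
      move=> [A minA ->]; pose B := if A i0 then neg_row A else A.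
      have BF0 : B \in F0.
        rewrite inE /B; case Ai: (A i0); rewrite ?neg_rowE ?Ai ?minA //.
        by rewrite (admissible_half_min.1 _ minA).
      exists (n + index B (enum F0))%N.
        by rewrite size_pairs ltn_add2l cardE index_mem mem_enum.
      rewrite nth_cat size_map size_enum_ord ltnNge leq_addr /= addKn.
      rewrite (nth_map B) ?index_mem ?mem_enum // nth_index ?mem_enum //.
      by rewrite /B; case: ifP => // _; rewrite half_sum_neg_row // pairN.
    by exists k.
  exact: card_le_trans le1 (card_le_trans le2 (card_image_le _ _)).
have final a b : (s <= n + b -> a = 2 * b -> a + 22 <= 8 * n -> s + 11 <= 5 * n)%N by lia.
exact: final le_s (card_half i0 false admissible_half_min)
  (card_admissible n6 admissible_half_min).
Qed.

End MinVectors.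

Theorem theorem8p1 (R : realType) (E : vectType R)
    (dot : {dot E for (@idfun R)}) (L : set E) (n s : nat)
    (dimE : \dim {:E} = n) (n_ge6 : (6 <= n)%N)
    (lattL : is_lattice L) (wrL : well_rounded dot L)
    (indexL : has_maximal_index dot L 2) (lengthL : has_length dot L n)
    (card_s : min_pairs dot L #= `I_s) :
  [/\ ((n %% 6 = 0)%N ->
         ((n = 6)%N -> (s <= 19)%N) /\
         ((12 <= n)%N ->
            s%:R <= (2 * n%:R ^+ 2 + 24 * n%:R - 45) / 9 :> rat)),
      ((n %% 6 = 1)%N ->
         ((n = 7)%N -> (s <= 24)%N) /\
         ((13 <= n)%N ->
            s%:R <= (2 * n%:R ^+ 2 + 20 * n%:R - 13) / 9 :> rat)),
      ((n %% 6 = 2)%N ->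
         ((n = 8)%N -> (s <= 32)%N) /\
         ((14 <= n)%N ->
            s%:R <= (2 * n%:R ^+ 2 + 22 * n%:R - 25) / 9 :> rat)),
      ((n %% 6 = 3)%N ->
         ((n = 9)%N -> (s <= 36)%N) /\
         ((15 <= n)%N ->
            s%:R <= (2 * n%:R ^+ 2 + 24 * n%:R - 54) / 9 :> rat)) &
      ((n %% 6 = 4)%N ->
         ((n = 10)%N -> (s <= 44)%N) /\
         ((16 <= n)%N ->
            s%:R <= (2 * n%:R ^+ 2 + 20 * n%:R - 4) / 9 :> rat)) /\
      ((n %% 6 = 5)%N ->
         s%:R <= (2 * n%:R ^+ 2 + 22 * n%:R - 34) / 9 :> rat)].
Proof.
have s5n : (s + 11 <= 5 * n)%N.
  (* Length [n] provides an even set of [n] independent minimal vectors, which serves as the frame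
     [e] with half sum [y]. *)
  case: lengthL => -[X [X0 minX freeX [y Ly sumX]] sizeX] length_min.
  pose e := Tuple (introT eqP sizeX).
  have basE : basis_of {:E} e.
    by rewrite basisEfree freeX subvf dimE sizeX leqnn.
  have n_gt0 : (0 < n)%N by apply: leq_trans n_ge6.
  exact: (card_min_pairs (e := e) basE lattL minX Ly sumX indexL.2 length_min
    n_gt0 card_s n_ge6).
have sR : s%:R + 11 <= 5 * n%:R :> rat by rewrite -natrD -natrM ler_nat.
have quad k : (k <= n)%N -> k%:R <= n%:R :> rat by rewrite ler_nat.
(* The bound [5 * n - 11] gives exactly 19 and 24 for [n = 6] and [n = 7], and lies strictly below
   the required value in all other cases. *)
split=> [_|_|_|_|]; [| | | |split=> [_|n5]].
- by split=> [|/quad]; [lia | rewrite ler_pdivlMr //; nra].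
- by split=> [|/quad]; [lia | rewrite ler_pdivlMr //; nra].
- by split=> [|/quad]; [lia | rewrite ler_pdivlMr //; nra].
- by split=> [|/quad]; [lia | rewrite ler_pdivlMr //; nra].
- by split=> [|/quad]; [lia | rewrite ler_pdivlMr //; nra].
- have /quad n11 : (11 <= n)%N by lia.
  by rewrite ler_pdivlMr //; nra.
Qed.
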